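(* Let $T$ be a finite event tree with root $v_0$, and let $C_0$ be the CEG of $T$ with the finest partition of situations into stages. Let $\Lambda$ be the set of root-to-leaf paths of $T$. Let the (uncertain) rates at which units take the paths be positive real random variables $\gamma(\lambda)$, $\lambda\in\Lambda$, each having a probability density. For a situation $v$ let $\gamma(v)=\sum_{\lambda\ni v}\gamma(\lambda)$ be the rate at which units arrive at $v$, for an edge $e$ let $\gamma(e)=\sum_{\lambda\ni e}\gamma(\lambda)$, and for a situation $v$ with outgoing edges $e_1,\dots,e_k$ let $\boldsymbol{\pi}_v=(\gamma(e_1)/\gamma(v),\dots,\gamma(e_k)/\gamma(v))$ be the vector of probabilities of which edge a unit takes after arriving at $v$. Assume: (path independence) the random variables $\gamma(\lambda)$, $\lambda\in\Lambda$, are mutually independent; and (floret independence) for every situation $v$, the vector $\boldsymbol{\pi}_v$ is independent of $\gamma(v)$. Then the vectors $\boldsymbol{\pi}_v$, where $v$ ranges over the situations with at least two outgoing edges (the non-trivial florets of $C_0$), are mutually independent and each has a Dirichlet distribution.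
   Context: An event tree $T$ is a finite directed rooted tree; its situations are its non-leaf nodes. The floret of a situation $v$ is the subtree consisting of $v$, its children and the edges from $v$ to its children. A floret is non-trivial if it has at least two edges. Each situation $v$ has an associated vector of (prior-uncertain) conditional probabilities on its outgoing edges; the probability of a root-to-leaf path is the product of the edge probabilities along it. A chain event graph (CEG) on $T$ is identified with a partition of the situations into stages, where situations in the same stage share the same edge-probability vector (under a bijection of their edges). $C_0$ denotes the CEG with the finest partition: each situation with at least two outgoing edges is in its own stage, so $C_0$ imposes no equalities between the edge-probability vectors of non-trivial florets. *)

(* Defs.v *)
From HB Require Import structures.
From mathcomp Require Import all_boot all_order all_algebra.
From mathcomp Require Import all_classical all_reals all_analysis.

Set Implicit Arguments.
Unset Strict Implicit.
Unset Printing Implicit Defensive.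

Import Order.TTheory GRing.Theory Num.Theory.
Import numFieldNormedType.Exports.

Local Open Scope ring_scope.

Section event_tree.
Context (V : finType) (e : rel V) (v0 : V).

(* Unicity is among all directed walks, so it excludes cycles and nodes with
   two parents. *)
Definition event_tree : Prop :=
  forall v : V, exists! p : seq V, path e v0 p /\ last v0 p = v.

Definition children (v : V) : {set V} := [set w | e v w].

Definition outdeg (v : V) : nat := #|children v|.

(* The head of the [i]-th outgoing edge of [v]. *)
Definition child (v : V) (i : 'I_(outdeg v)) : V := enum_val i.

Definition situations : {set V} := [set v | (0 < outdeg v)%N].

(* Paths are listed with their root. *)
Definition root_to_leaf (s : seq V) : bool :=
  if s is x :: p then [&& x == v0, path e x p & last x p \notin situations]
  else false.

(* The length bound only serves to obtain a finite type: see
   [size_root_to_leaf]. *)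
Definition rtl_path : finType := {s : #|V|.-bseq V | root_to_leaf s}.

Lemma size_root_to_leaf (s : seq V) :
  event_tree -> root_to_leaf s -> (size s <= #|V|)%N.
Proof.
move=> tree; case: s => // x p /and3P[/eqP-> ep _].
have [q [_ uq]] := tree (last v0 p).
have pq := uq p (conj ep erefl).
case: (shortenP ep) (uq (shorten v0 p)) => p' ep' up' _ => /(_ (conj ep' erefl)).
by rewrite -pq => pp'; rewrite pp' in up' *; rewrite -(card_uniqP up') max_card.
Qed.

(* A chain event graph on the tree is given by its partition of the situations
   into stages. In the finest one stages are singletons, so no two florets are
   identified. *)
Definition finest_staging : {set {set V}} := [set [set v] | v in situations].

Definition nontrivial_florets (C : {set {set V}}) : {set V} :=
  [set v in finset.cover C | (1 < outdeg v)%N].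

Section rates.
Context (R : realType) (Omega : Type) (gamma : rtl_path -> Omega -> R).

Definition node_rate (v : V) (omega : Omega) : R :=
  \sum_(l : rtl_path | v \in (val l : seq V)) gamma l omega.

Definition edge_rate (v w : V) (omega : Omega) : R :=
  \sum_(l : rtl_path | infix [:: v; w] (val l : seq V)) gamma l omega.

Definition floret_probs (v : V) (omega : Omega) : (outdeg v).-tuple R :=
  [tuple edge_rate v (child i) omega / node_rate v omega | i < outdeg v].

End rates.
End event_tree.

Local Open Scope classical_set_scope.

Section probability.
Context (d : measure_display) (Omega : measurableType d) (R : realType)
  (P : probability Omega R).

Definition has_density (X : {RV P >-> R}) : Prop :=
  exists f : R -> R,
    [/\ measurable_fun [set: R] f, forall x, 0 <= f x &
        forall A : set R, measurable A ->
          distribution P X A = (\int[lebesgue_measure]_(x in A) (f x)%:E)%E].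

Definition independent2 (d1 d2 : measure_display)
    (T1 : measurableType d1) (T2 : measurableType d2)
    (X : Omega -> T1) (Y : Omega -> T2) : Prop :=
  forall (A : set T1) (B : set T2), measurable A -> measurable B ->
    P (X @^-1` A `&` Y @^-1` B) = (P (X @^-1` A) * P (Y @^-1` B))%E.

Definition mutually_independent (I : finType) (D : {set I})
    (d' : measure_display) (T : I -> measurableType d')
    (X : forall i, Omega -> T i) : Prop :=
  forall J : {set I}, J \subset D ->
  forall A : forall i, set (T i), (forall i, measurable (A i)) ->
    P (\bigcap_(i in [set` J]) (X i @^-1` A i)) =
      (\prod_(i in J) P (X i @^-1` A i))%E.

End probability.

Section dirichlet.
Context (R : realType).

Definition gamma_fun (a : R) : R :=
  \int[lebesgue_measure]_(t in `]0, +oo[) (t `^ (a - 1) * expR (- t)).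

(* Integration with respect to [n]-dimensional Lebesgue measure, as an iterated
   integral; it is only used on nonnegative measurable functions. *)
Fixpoint iter_integral (n : nat) : (n.-tuple R -> \bar R) -> \bar R :=
  match n return (n.-tuple R -> \bar R) -> \bar R with
  | 0 => fun f => f [tuple]
  | n'.+1 => fun f =>
      (\int[lebesgue_measure]_x iter_integral (fun t => f [tuple of x :: t]))%E
  end.

(* [(t_1, ..., t_(k-1), 1 - t_1 - ... - t_(k-1))] : the default value of [nth]
   provides the last coordinate. *)
Definition simplex_point (k : nat) (t : k.-1.-tuple R) : k.-tuple R :=
  [tuple nth (1 - \sum_(j < k.-1) tnth t j) t i | i < k].

Definition dirichlet_density (k : nat) (alpha : 'I_k -> R) (x : k.-tuple R) : R :=
  if [forall i, 0 < tnth x i] then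
    gamma_fun (\sum_(i < k) alpha i) / (\prod_(i < k) gamma_fun (alpha i))
    * \prod_(i < k) tnth x i `^ (alpha i - 1)
  else 0.

(* The density is with respect to Lebesgue measure on the first [k - 1]
   coordinates; meaningful for [0 < k]. *)
Definition dirichlet (k : nat) (alpha : 'I_k -> R) (A : set (k.-tuple R)) : \bar R :=
  iter_integral (fun t : k.-1.-tuple R =>
    (dirichlet_density alpha (simplex_point t) * \1_A (simplex_point t))%:E).

Definition has_dirichlet_distribution (d : measure_display)
    (Omega : measurableType d) (P : probability Omega R)
    (k : nat) (X : Omega -> k.-tuple R) : Prop :=
  exists2 alpha : 'I_k -> R, (forall i, 0 < alpha i) &
    forall A : set (k.-tuple R), measurable A ->
      P (X @^-1` A) = dirichlet alpha A.

End dirichlet.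

(* Main.v *)
Require Import Defs.
From HB Require Import structures.
From mathcomp Require Import all_boot all_order all_algebra.
From mathcomp Require Import all_classical all_reals all_analysis.
From mathcomp Require Import measurable_realfun ring lra.

(** The children of a situation receive independent rates, being sums over disjoint
    sets of paths. Going up the tree, the rate of a node and all the floret vectors
    of the subtree below it are then mutually independent: the floret vector and
    the rate of a situation are functions of the rates of its children, and floret
    independence separates one from the other.

    The Dirichlet part is a form of Lukacs' theorem. Let the rates [X_i] of the
    children have sum [S], and put [a_i n = E (X_i ^ n exp (- X_i))]. Path and floret
    independence give [\prod_i a_i (e_i) = E (\prod_i (X_i / S) ^ e_i) s (\sum_i e_i)]
    with [s n = E (S ^ n exp (- S))]. As the [X_i / S] add up to 1, the sum of the
    ratios [a_i (e_i + 1) / a_i (e_i)] depends on [\sum_i e_i] only. Hence these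
    ratios are arithmetic progressions with a common difference, positive because a
    density excludes constant rates, and the moments of the floret vector are those
    of a Dirichlet distribution. On the unit cube a distribution is determined by its
    moments, indicators of boxes being bounded limits of polynomials. *)

Set Implicit Arguments.
Unset Strict Implicit.
Unset Printing Implicit Defensive.

Import Order.TTheory GRing.Theory Num.Theory.
Import numFieldNormedType.Exports.

Local Open Scope classical_set_scope.
Local Open Scope ring_scope.

(** * Lebesgue integrals over tuples *)

(** The rates may have infinite moments, hence the weight [exp (- x)]: it makes every power of a
    rate bounded, and the product of the [exp (- X_i)] is [exp (- S)], a function of [S], so floret
    independence still applies to the weighted monomials. Floret independence only relates a floret
    vector to the rate of its own node. To join it with the florets further down, the induction
    works at [v] with the sigma-algebra generated by the rates of its children. It is rich enough to
    determine the rate and the floret vector of [v], and poor enough to be independent of all lower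
    florets, unlike the sigma-algebra of the path rates. A Dirichlet law is carried by the
    hyperplane where the coordinates add up to 1 and has no density in all [k] coordinates. It is
    therefore handled as the image of a weighted measure on [k - 1] coordinates, and laws are
    compared in a form that covers such images. *)

Section affine_substitution.
Context (R : realType).
Local Notation leb := (@lebesgue_measure R).
Local Open Scope ereal_scope.

(** The image of Lebesgue measure under a translation agrees with it on half-open intervals, hence
    everywhere. Scaling below is treated likewise, up to the factor [c]. *)
Lemma ge0_integral_shift (f : R -> \bar R) (c : R) :
  measurable_fun [set: R] f -> (forall x, 0 <= f x) ->
  \int[leb]_x f (x + c)%R = \int[leb]_x f x.
Proof.
move=> mf f0.
pose phi : measurableTypeR R -> measurableTypeR R := fun x => (x + c)%R.
have mphi : measurable_fun [set: measurableTypeR R] phi by exact: measurable_funD.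
rewrite -[LHS](ge0_integral_pushforward mphi leb (f := f) measurableT) //.
apply: eq_measure_integral => //= A mA _.
apply/esym/lebesgue_measure_unique => //= _ [[a b]] _ <-.
rewrite /pushforward (_ : phi @^-1` _ = `](a - c)%R, (b - c)%R]%classic); last first.
  by apply/seteqP; split => x /=; rewrite !in_itv /= ltrBlDr lerBrDr.
rewrite !lebesgue_measure_itv /= !lte_fin ltrD2r; case: ifP => // _.
by rewrite -!EFinB opprB addrA subrK.
Qed.

Lemma ge0_integral_scale (f : R -> \bar R) (c : R) : (0 < c)%R ->
  measurable_fun [set: R] f -> (forall x, 0 <= f x) ->
  \int[leb]_x f x = c%:E * \int[leb]_x f (c * x)%R.
Proof.
move=> c0 mf f0.
pose phi : measurableTypeR R -> measurableTypeR R := fun x => (c * x)%R.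
have mphi : measurable_fun [set: measurableTypeR R] phi by exact: measurable_funM.
rewrite -[X in _ * X](ge0_integral_pushforward mphi leb (f := f) measurableT) //.
pose k : {nonneg R} := NngNum (ltW c0).
rewrite -[c]/(k%:num) -ge0_integral_mscale //.
apply: eq_measure_integral => //= A mA _.
apply/lebesgue_measure_unique => //= _ [[a b]] _ <-.
rewrite /mscale /= /mscale /pushforward.
set B := phi @^-1` _.
have -> : B = `](a / c)%R, (b / c)%R]%classic.
  apply/seteqP; split => x /=; rewrite !in_itv /= /phi;
    by rewrite ltr_pdivrMr // ler_pdivlMr // ![(x * c)%R]mulrC.
rewrite !lebesgue_measure_itv /= !lte_fin ltr_pM2r ?invr_gt0 //.
case: ifP => // _; last by rewrite mule0.
by rewrite -!EFinB -EFinM -mulrBl mulrCA mulfV ?mulr1 // gt_eqF.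
Qed.

End affine_substitution.

Section iter_integral.
Context (R : realType).
Local Open Scope ereal_scope.

(** The product measure is transported along [cons]. Sigma-finiteness does not come with the
    pushforward and is shown with products of two exhausting sequences. *)
Lemma tuple_product_measure 
    (m0 : {sigma_finite_measure set (measurableTypeR R) -> \bar R})
    (n : nat) (m : {sigma_finite_measure set (n.-tuple R) -> \bar R}) :
  exists M : {sigma_finite_measure set (n.+1.-tuple R) -> \bar R},
    forall f : n.+1.-tuple R -> \bar R, measurable_fun setT f ->
      (forall x, 0 <= f x) ->
      \int[M]_x f x = \int[m0]_x \int[m]_t f [tuple of x :: t].
Proof.
pose phi (z : measurableTypeR R * n.-tuple R) : n.+1.-tuple R := [tuple of z.1 :: z.2].
have mphi : measurable_fun setT phi by exact: measurable_cons.
pose m1 : {measure set (n.+1.-tuple R) -> \bar R} := 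
  measure_function_pushforward__canonical__measure_function_Measure
    (m0 \x m)%E mphi.
have sm1 : sigma_finite setT m1.
  have /sigma_finiteP[F [FT ndF Foo]] := sigma_finiteT m0.
  have /sigma_finiteP[G [GT ndG Goo]] := sigma_finiteT m.
  exists (fun i => [set t : n.+1.-tuple R | F i (thead t) /\ G i [tuple of behead t]]).
    apply/esym; rewrite -subTset => t _.
    have : setT (thead t) by []; rewrite FT => -[i _ Fi].
    have : setT [tuple of behead t] by []; rewrite GT => -[j _ Gj].
    (* Both sequences are nondecreasing, so one index serves for head and tail. *)
    exists (maxn i j) => //; split.
    - by move: Fi; exact/subsetPset/ndF/leq_maxl.
    - by move: Gj; exact/subsetPset/ndG/leq_maxr.
  move=> i; have [mFi Fioo] := Foo i; have [mGi Gioo] := Goo i; split.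
    apply: measurableI; rewrite -[X in measurable X]setTI.
      exact: measurable_tnth.
    exact: (@measurable_behead _ R n measurableT).
  rewrite /= /pushforward; set B := phi @^-1` _.
  have -> // : B = F i `*` G i.
    apply/funext => -[x t].
    have e : [tuple of behead (phi (x, t))] = t :> n.-tuple R by exact/val_inj.
    by rewrite /B /preimage /mkset e theadE.
  by rewrite product_measure1E // lte_mul_pinfty // ge0_fin_numE.
pose M2 := Measure_isSigmaFinite.Build _ _ _ (m1 : _ -> _) sm1.
pose M : {sigma_finite_measure set (n.+1.-tuple R) -> \bar R} :=
  HB.pack (m1 : _ -> _) (Measure.on m1) M2.
exists M => f mf f0 /=.
rewrite (ge0_integral_pushforward mphi _ (f := f) measurableT) //=.
rewrite fubini_tonelli1 //=; exact: measurableT_comp.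
Qed.

(** Iterated integrals become integrals against one measure, so that linearity, Tonelli and
    dominated convergence apply to them. *)
Lemma iter_integral_measure (n : nat) :
  exists m : {sigma_finite_measure set (n.-tuple R) -> \bar R},
    forall f : n.-tuple R -> \bar R, measurable_fun setT f ->
      (forall x, 0 <= f x) -> \int[m]_x f x = iter_integral f.
Proof.
elim: n => [|n [m IH]].
  exists (dirac ([tuple] : 0.-tuple R)) => f mf f0.
  by rewrite integral_dirac // diracT mul1e.
have [M HM] := tuple_product_measure (@lebesgue_measure R) m.
exists M => f mf f0; rewrite HM //.
apply: eq_integral => x _; rewrite IH //.
by apply: measurableT_comp => //; exact: measurable_cons.
Qed.

End iter_integral.

(** * The Gamma function *)

Section gamma_integral.
Context (R : realType).
Local Notation leb := (@lebesgue_measure R).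

(* [x `^ (a - 1)] cut off outside of the positive reals, where [powR] takes junk
   values. *)
Definition powpos (a x : R) : R := if 0 < x then x `^ (a - 1) else 0.

Lemma powpos_ge0 a x : 0 <= powpos a x.
Proof. by rewrite /powpos; case: ifP => // _; exact: powR_ge0. Qed.

Lemma measurable_powpos a : measurable_fun [set: R] (powpos a).
Proof.
by apply: measurable_fun_ifT => //; exact: measurable_fun_ltr.
Qed.

Lemma powposM a c x : 0 < c -> powpos a (c * x) = c `^ (a - 1) * powpos a x.
Proof.
move=> c0; rewrite /powpos pmulr_rgt0 //; case: ifP => x0; last by rewrite mulr0.
by rewrite powRM // ltW.
Qed.

Lemma powposD a n x : powpos a x * x ^+ n = powpos (a + n%:R) x.
Proof.
rewrite /powpos; case: ifP => x0; last by rewrite mul0r.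
rewrite -powR_mulrn ?ltW // -powRD; first by rewrite addrAC.
by rewrite (gt_eqF x0) implybT.
Qed.

Local Open Scope ereal_scope.

(** For [a < 1] the integrand is unbounded at 0. The fundamental theorem is applied on intervals
    away from 0 that increase to []0, t]], and both sides pass to the limit. *)
Lemma integral_powpos_itv (a t : R) : (0 < a)%R ->
  \int[leb]_s (if (s < t)%R then (a * powpos a s)%R else 0%R)%:E =
  (powpos (a + 1)%R t)%:E.
Proof.
move=> a0; rewrite /powpos addrK; case: ifPn => [t0|]; last first.
  rewrite -leNgt => t0; rewrite integral0_eq // => s _.
  case: ifPn => // st; rewrite ifF ?mulr0 //.
  by apply/negbTE; rewrite -leNgt (le_trans (ltW st)).
(* The divisor starts at 2 so that the lower end is strictly below [t] already for [i = 0]. *)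
pose F i : set R := `[(t / i.+2%:R)%R, t]%classic.
pose f (s : R) := (a * s `^ (a - 1))%R.
have ti i : (0 < t / i.+2%:R)%R by rewrite divr_gt0.
have tit i : (t / i.+2%:R < t)%R by rewrite ltr_pdivrMr // ltr_pMr // ltr1n.
have FU : \bigcup_i F i = `]0%R, t]%classic.
  apply/seteqP; split => [s [i _]|s] /=.
    rewrite /F /= !in_itv /= => /andP[h ->]; rewrite andbT.
    exact: lt_le_trans (ti i) h.
  rewrite in_itv /= => /andP[s0 st]; exists (Num.bound (t / s)) => //=.
  rewrite /F /= in_itv /= st andbT ler_pdivrMr // -ler_pdivrMl // mulrC.
  apply: le_trans (ltW (archi_boundP _)) _; first by rewrite divr_ge0 // ltW.
  by rewrite ler_nat; apply: leq_trans (leqnSn _).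
have nF : nondecreasing_seq F.
  move=> i j ij; apply/subsetPset => s; rewrite /F /= !in_itv /= => /andP[h ->].
  rewrite andbT; apply: le_trans h.
  by rewrite ler_pM2l // lef_pV2 ?posrE // ler_nat !ltnS.
have mf : measurable_fun setT (EFin \o f).
  by apply/measurable_EFinP; apply: measurable_funM => //; exact: measurable_powR.
have intF i : \int[leb]_(s in F i) (f s)%:E = (t `^ a - (t / i.+2%:R) `^ a)%:E.
  have df x : (0 < x)%R -> {for x, continuous (fun s : R => s `^ (a - 1))%R}.
    by move=> x0; apply: differentiable_continuous; apply/derivable1_diffP;
       apply: derivable_powR; rewrite in_itv /= x0.
  have dF x : (0 < x)%R -> {for x, continuous (fun s : R => s `^ a)%R}.
    by move=> x0; apply: differentiable_continuous; apply/derivable1_diffP;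
       apply: derivable_powR; rewrite in_itv /= x0.
  rewrite (@continuous_FTC2 _ f (fun s => s `^ a)%R) //.
  - apply: continuous_in_subspaceT => x /[!inE] /=; rewrite in_itv /= => /andP[h _].
    apply: cvgM; first exact: cvg_cst.
    by apply: df; apply: lt_le_trans h.
  - split.
    + move=> x; rewrite in_itv /= => /andP[h _]; apply: derivable_powR.
      by rewrite in_itv /= andbT (lt_trans _ h).
    + by apply: cvg_at_right_filter; exact: dF.
    + by apply: cvg_at_left_filter; exact: dF.
  - move=> x; rewrite in_itv /= => /andP[h _]; rewrite powR_derive1 //.
    by rewrite in_itv /= andbT (lt_trans _ h).
have lim1 : \int[leb]_(s in F i) (f s)%:E @[i --> \oo] -->
    \int[leb]_(s in `]0%R, t]) (f s)%:E.
  rewrite -FU; apply: ge0_nondecreasing_set_cvg_integral => //.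
  - by move=> i; exact: measurable_itv.
  - by move=> i; exact: measurable_funTS.
  - by move=> i s _; rewrite lee_fin mulr_ge0 ?powR_ge0 // ltW.
have lim2 : \int[leb]_(s in F i) (f s)%:E @[i --> \oo] --> (t `^ a)%:E.
  rewrite (_ : (fun i => _) = EFin \o (fun i => t `^ a - (t / i.+2%:R) `^ a)%R); last first.
    by apply/funext => i; rewrite intF.
  apply: cvg_EFin; first by near=> i.
  rewrite -[X in _ --> X]subr0; apply: cvgB; first exact: cvg_cst.
  have /cvg_at_rightP := powR_cvg0 a0; apply; split => //.
  rewrite -[X in _ --> X](mulr0 t); apply: cvgMr.
  have := @cvg_harmonic R; rewrite -(cvg_shiftS (@harmonic R : nat -> R^o)).
  exact.
rewrite -(cvg_unique _ lim1 lim2) //.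
rewrite -integral_itv_bndo_bndc; last exact: measurable_funTS.
rewrite [RHS]integral_mkcond; apply: eq_integral => s _.
rewrite patchE mem_setE in_itv /=.
case: (ltP s t) => st; case: (ltP 0%R s) => s0 //=; rewrite ?mulr0 //.
Unshelve. all: by end_near. Qed.

Lemma integral_expRN_itv (s : R) :
  \int[leb]_t (if (s < t)%R then expR (- t) else 0%R)%:E = (expR (- s))%:E.
Proof.
transitivity (\int[leb]_(t in `]s, +oo[) (expR (- t))%:E).
  rewrite [RHS]integral_mkcond; apply: eq_integral => t _.
  by rewrite patchE mem_setE in_itv /= andbT; case: ifPn.
have ce : continuous (fun t : R => expR (- t)).
  by move=> x; apply: continuous_comp; [exact: opp_continuous|exact: continuous_expR].
rewrite integral_itv_obnd_cbnd; last first.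
  by apply/measurable_EFinP; apply: measurable_funTS; exact: continuous_measurable_fun.
rewrite (@ge0_continuous_FTC2y _ _ (fun t => - expR (- t))%R _ 0%R) //.
- by rewrite EFinN oppeK add0e.
- exact: continuous_subspaceT.
- by rewrite -oppr0; apply: cvgN; exact: cvgr_expR.
- by apply: cvgN; apply/cvg_at_right_filter; exact: ce.
- move=> x _; rewrite derive1E derive_val /=.
  by rewrite mulrN1 opprK.
Qed.

Definition gamma_integral (a : R) : \bar R :=
  \int[leb]_x (powpos a x * expR (- x))%:E.

Lemma measurable_expRN : measurable_fun [set: R] (fun x : R => expR (- x)).
Proof. by apply: measurableT_comp => //; exact: measurable_funN. Qed.

(** Instead of integrating by parts, [h] is integrated over the region [x < y] in both orders. The
    identity holds in the extended reals, so it can serve to prove finiteness below. *)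
Lemma gamma_integralD1 (a : R) : (0 < a)%R ->
  gamma_integral (a + 1)%R = a%:E * gamma_integral a.
Proof.
move=> a0.
pose h (z : R * R) : \bar R :=
  (if (z.1 < z.2)%R then a * powpos a z.1 * expR (- z.2) else 0)%:E.
have h0 z : 0 <= h z.
  by rewrite /h lee_fin; case: ifP => // _; rewrite !mulr_ge0 ?powpos_ge0 ?expR_ge0 // ltW.
have mh : measurable_fun setT h.
  apply/measurable_EFinP; apply: measurable_fun_ifT => //.
    by apply: measurable_fun_ltr.
  apply: measurable_funM.
    apply: measurable_funM => //.
    by apply: measurableT_comp => //; exact: measurable_powpos.
  exact: (measurableT_comp measurable_expRN measurable_snd).
have := fubini_tonelli (m1 := leb) (m2 := leb) h mh h0.
rewrite /h /=.
have -> : \int[leb]_x \int[leb]_y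
    (if (x < y)%R then a * powpos a x * expR (- y) else 0)%:E =
    a%:E * gamma_integral a.
  rewrite /gamma_integral -ge0_integralZl //; last 3 first.
  - apply/measurable_EFinP; apply: measurable_funM; first exact: measurable_powpos.
    exact: measurable_expRN.
  - by move=> x _; rewrite lee_fin mulr_ge0 ?powpos_ge0 ?expR_ge0.
  - by rewrite lee_fin ltW.
  apply: eq_integral => x _.
  rewrite -[RHS]EFinM mulrA EFinM -integral_expRN_itv -ge0_integralZl //; last 3 first.
  - apply/measurable_EFinP; apply: measurable_fun_ifT => //.
      exact: measurable_fun_ltr.
    exact: measurable_expRN.
  - by move=> y _; rewrite lee_fin; case: ifP => // _; exact: expR_ge0.
  - by rewrite lee_fin mulr_ge0 ?powpos_ge0 // ltW.
  by apply: eq_integral => y _; rewrite -EFinM; case: ifP => // _; rewrite mulr0.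
move=> ->; apply: eq_integral => y _.
rewrite EFinM -integral_powpos_itv // -ge0_integralZr //; last 2 first.
- apply/measurable_EFinP; apply: measurable_fun_ifT => //.
    exact: measurable_fun_ltr.
  by apply: measurable_funM => //; exact: measurable_powpos.
- by move=> x _; rewrite lee_fin; case: ifP => // _; rewrite mulr_ge0 ?powpos_ge0 // ltW.
by apply: eq_integral => x _; rewrite -EFinM; case: ifP => // _; rewrite mul0r.
Qed.

Lemma gamma_integral_gt0 (a : R) : 0 < gamma_integral a.
Proof.
have mf : measurable_fun [set: R] (EFin \o (fun x => powpos a x * expR (- x))%R).
  apply/measurable_EFinP; apply: measurable_funM; first exact: measurable_powpos.
  exact: measurable_expRN.
rewrite lt0e integral_ge0 ?andbT; last first.
  by move=> x _; rewrite lee_fin mulr_ge0 ?powpos_ge0 ?expR_ge0.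
apply/eqP => h.
have : \int[leb]_(x in setT) `|(EFin \o (fun x => powpos a x * expR (- x))%R) x| = 0.
  rewrite -h; apply: eq_integral => x _ /=.
  by rewrite ger0_norm // mulr_ge0 ?powpos_ge0 ?expR_ge0.
move/(ae_eq_integral_abs leb measurableT mf).1 => [N [mN N0 sub]].
have : leb `]0%R, 1%R[%classic <= 0.
  rewrite -N0; apply: le_measure; rewrite ?inE //.
  move=> x /=; rewrite in_itv /= => /andP[x0 _]; apply: sub => /= /(_ I).
  rewrite /powpos x0 => -[] /eqP.
  by rewrite mulf_eq0 gt_eqF ?powR_gt0 //= gt_eqF ?expR_gt0.
by rewrite lebesgue_measure_itv /= lte_fin ltr01 -EFinB subr0 lee_fin ler10.
Qed.

Lemma gamma_integral_lt_pinfty (a : R) : (0 < a)%R -> gamma_integral a < +oo.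
Proof.
move=> a0.
suff H n : forall b, (0 < b <= n.+1%:R)%R -> gamma_integral b < +oo.
  apply: (H (Num.bound a)); rewrite a0 /= (le_trans (ltW (archi_boundP _))) ?ltW //.
  by rewrite ltr_nat.
elim: n => [|n IH] b /andP[b0 bn]; last first.
  have [b1|b1] := leP b 1%R.
    by apply: IH; rewrite b0 (le_trans b1) // ler1n.
  rewrite -(subrK 1%R b) gamma_integralD1 ?subr_gt0 // lte_mul_pinfty //.
  - by rewrite lee_fin subr_ge0 ltW.
  - by apply: IH; rewrite subr_gt0 b1 lerBlDr -natr1 /= in bn *.
have mp : measurable_fun [set: R] (fun x => powpos b x * expR (- x))%R.
  by apply: measurable_funM; [exact: measurable_powpos|exact: measurable_expRN].
(* The dominating function is [b^-1 * g1 + g2]; the factor [b] gives [g1] the form whose integral is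
   known. *)
pose g1 (s : R) := ((if (s < 1)%R then (b * powpos b s)%R else 0%R)%:E).
pose g2 (s : R) := ((if (0 < s)%R then expR (- s) else 0%R)%:E).
have g10 s : 0 <= g1 s.
  by rewrite lee_fin; case: ifP => // _; rewrite mulr_ge0 ?powpos_ge0 // ltW.
have g20 s : 0 <= g2 s.
  by rewrite lee_fin; case: ifP => // _; exact: expR_ge0.
have mg1 : measurable_fun setT g1.
  apply/measurable_EFinP; apply: measurable_fun_ifT => //.
    exact: measurable_fun_ltr.
  by apply: measurable_funM => //; exact: measurable_powpos.
have mg2 : measurable_fun setT g2.
  apply/measurable_EFinP; apply: measurable_fun_ifT => //.
    exact: measurable_fun_ltr.
  exact: measurable_expRN.
have : \int[leb]_x (b^-1%:E * g1 x + g2 x) < +oo.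
  rewrite ge0_integralD //; last 2 first.
  - by move=> x _; rewrite mule_ge0 // lee_fin invr_ge0 ltW.
  - exact: measurable_funeM.
  rewrite ge0_integralZl //; last by rewrite lee_fin invr_ge0 ltW.
  by rewrite /g1 integral_powpos_itv // /g2 integral_expRN_itv -EFinM -EFinD ltry.
apply: le_lt_trans; apply: ge0_le_integral => //.
- by move=> x _; rewrite lee_fin mulr_ge0 ?powpos_ge0 ?expR_ge0.
- exact/measurable_EFinP.
- by apply: emeasurable_funD => //; exact: measurable_funeM.
move=> x _; rewrite /g1 /g2 -EFinM -EFinD lee_fin /powpos.
case: (ltP 0%R x) => x0; last by rewrite mul0r !mulr0 if_same addr0 mulr0.
case: (ltP x 1%R) => x1.
  rewrite mulrA mulVf ?gt_eqF // mul1r.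
  apply: ler_wpDr; first exact: expR_ge0.
  by rewrite ler_piMr ?powR_ge0 // -expR0 ler_expR oppr_le0 ltW.
rewrite mulr0 add0r ler_piMl ?expR_ge0 //.
have b1 : (b - 1 <= 0)%R by rewrite subr_le0.
by have := ler_powR x1 b1; rewrite powRr0.
Qed.

(** [gamma_fun] is [fine] of an extended integral; finiteness makes it the true value. *)
Lemma gamma_integralE (a : R) : (0 < a)%R -> gamma_integral a = (gamma_fun a)%:E.
Proof.
move=> a0; rewrite /gamma_fun /Rintegral.
have -> : \int[leb]_(x in `]0%R, +oo[) (x `^ (a - 1) * expR (- x))%:E = gamma_integral a.
  rewrite [LHS]integral_mkcond; apply: eq_integral => x _.
  rewrite patchE mem_setE in_itv /= andbT /powpos; case: ifP => // _.
  by rewrite mul0r.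
by rewrite fineK // ge0_fin_numE ?gamma_integral_lt_pinfty // ltW // gamma_integral_gt0.
Qed.

Lemma gamma_fun_gt0 (a : R) : (0 < a)%R -> (0 < gamma_fun a)%R.
Proof. by move=> a0; rewrite -lte_fin -gamma_integralE // gamma_integral_gt0. Qed.

Lemma gamma_funD1 (a : R) : (0 < a)%R -> gamma_fun (a + 1) = (a * gamma_fun a)%R.
Proof.
move=> a0; apply: EFin_inj.
by rewrite EFinM -!gamma_integralE ?addr_gt0 // gamma_integralD1.
Qed.

End gamma_integral.

(** * Moments of the Dirichlet distribution *)

Section iter_integral_theory.
Context (R : realType).
Local Notation leb := (@lebesgue_measure R).
Local Open Scope ereal_scope.

Lemma iter_integral_ge0 n (f : n.-tuple R -> \bar R) :
  (forall t, 0 <= f t) -> 0 <= iter_integral f.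
Proof.
elim: n => [|n IH] in f * => f0 //=.
by apply: integral_ge0 => x _; apply: IH.
Qed.

Lemma iter_integralZl n (c : R) (f : n.-tuple R -> \bar R) : (0 <= c)%R ->
  measurable_fun setT f -> (forall t, 0 <= f t) ->
  iter_integral (fun t => c%:E * f t) = c%:E * iter_integral f.
Proof.
move=> c0 mf f0; have [m Hm] := iter_integral_measure R n.
rewrite -!Hm //.
- by rewrite ge0_integralZl.
- exact: measurable_funeM.
- by move=> t; rewrite mule_ge0.
Qed.

Lemma measurable_iter_integral n (f : measurableTypeR R * n.-tuple R -> \bar R) :
  measurable_fun setT f -> (forall z, 0 <= f z) ->
  measurable_fun [set: measurableTypeR R] (fun x => iter_integral (fun t => f (x, t))).
Proof.
move=> mf f0; have [m Hm] := iter_integral_measure R n.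
rewrite (_ : (fun x => _) = fubini_F m f); last first.
  apply/funext => x; rewrite /fubini_F Hm //.
  by apply: measurableT_comp.
exact: measurable_fun_fubini_tonelli_F.
Qed.

Lemma iter_integral_scale n (c : R) (f : n.-tuple R -> \bar R) : (0 < c)%R ->
  measurable_fun setT f -> (forall t, 0 <= f t) ->
  iter_integral f =
  (c ^+ n)%:E * iter_integral (fun t => f (map_tuple ( *%R c) t)).
Proof.
move=> c0; elim: n f => [|n IH] f mf f0.
  by rewrite expr0 mul1e /=; congr f; exact/val_inj.
have mfc : measurable_fun [set: measurableTypeR R * n.-tuple R]
    (fun z => f [tuple of z.1 :: z.2]).
  by apply: measurableT_comp => //; exact: measurable_cons.
have mmap : measurable_fun [set: n.-tuple R] (map_tuple ( *%R c)).
  apply/measurable_fun_tnthP => i.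
  rewrite (_ : _ \o _ = (fun x => c * x)%R \o (fun t => tnth t i)); last first.
    by apply/funext => t /=; rewrite tnth_map.
  apply: measurableT_comp; last exact: measurable_tnth.
  exact: measurable_funM.
rewrite /= (ge0_integral_scale c0) //; last 2 first.
- exact: (measurable_iter_integral (f := fun z => f [tuple of z.1 :: z.2])).
- by move=> x; exact: iter_integral_ge0.
rewrite exprS EFinM -muleA; congr (_ * _).
rewrite -ge0_integralZl //; last 3 first.
- pose g := (fun z : measurableTypeR R * n.-tuple R => f [tuple of z.1 :: z.2]) \o
    (fun z : measurableTypeR R * n.-tuple R => (c * z.1, map_tuple ( *%R c) z.2)%R).
  have mg : measurable_fun setT g.
    apply: measurableT_comp => //; apply: measurable_fun_pair => /=.
      exact: measurable_funM.
    exact: measurableT_comp.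
  have := measurable_iter_integral mg (fun=> f0 _).
  congr measurable_fun; apply/funext => x; congr iter_integral.
  by apply/funext => t; rewrite /g /=; congr f; exact/val_inj.
- by move=> x _; exact: iter_integral_ge0.
- by rewrite lee_fin exprn_ge0 // ltW.
apply: eq_integral => x _; rewrite IH //.
  by congr (_ * iter_integral _); apply/funext => t; congr f; exact/val_inj.
by apply: measurableT_comp => //; exact: measurable_cons.
Qed.

Lemma measurable_prod_tnth n (f : 'I_n -> R -> R) :
  (forall i, measurable_fun setT (f i)) ->
  measurable_fun [set: n.-tuple R] (fun t => \prod_i f i (tnth t i))%R.
Proof.
move=> mf; apply: measurable_prod => i _.
by apply: measurableT_comp => //; exact: measurable_tnth.
Qed.

Lemma iter_integral_prod n (f : 'I_n -> R -> R) :
  (forall i x, (0 <= f i x)%R) -> (forall i, measurable_fun setT (f i)) ->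
  iter_integral (fun t => (\prod_i f i (tnth t i))%:E) =
  \prod_i \int[leb]_x (f i x)%:E.
Proof.
elim: n => [|n IH] in f * => f0 mf; first by rewrite /= !big_ord0.
rewrite big_ord_recl /= -IH //.
rewrite -ge0_integralZr //; last 3 first.
- have mf0 : measurable_fun [set: measurableTypeR R] (EFin \o f ord0).
    by apply/measurable_EFinP; exact: mf.
  exact: mf0.
- by move=> x _; rewrite lee_fin.
- by apply: iter_integral_ge0 => t; rewrite lee_fin prodr_ge0.
apply: eq_integral => x _; rewrite -iter_integralZl //; last 2 first.
- apply/measurable_EFinP.
  by apply: (measurable_prod_tnth (f := fun i => f (lift ord0 i))).
- by move=> t; rewrite lee_fin prodr_ge0.
congr iter_integral; apply/funext => t; rewrite big_ord_recl -EFinM.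
congr (_ * _)%:E; apply: eq_bigr => i _; congr (f _ _).
by rewrite tnthS.
Qed.

Lemma powR_sum (s : R) n (a : 'I_n -> R) : (0 < s)%R ->
  (\prod_i s `^ (a i) = s `^ (\sum_i a i))%R.
Proof.
move=> s0; rewrite (big_morph (powR s) (id1 := 1%R) (op1 := *%R)) ?powRr0 //.
by move=> x y; rewrite powRD // (gt_eqF s0) implybT.
Qed.

(* Substituting [y = s - \sum_i t_i] in the product of the Gamma integrals, then
   scaling [t] by [s]. *)
Lemma dirichlet_normalization n (a : 'I_n -> R) (b : R) :
  (\prod_i gamma_integral (a i)) * gamma_integral b =
  gamma_integral (\sum_i a i + b)%R *
  iter_integral (fun t : n.-tuple R =>
    (\prod_i powpos (a i) (tnth t i) * powpos b (1 - \sum_i tnth t i))%:E).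
Proof.
have [m Hm] := iter_integral_measure R n.
pose pe (a x : R) := (powpos a x * expR (- x))%R.
have pe0 (c x : R) : (0 <= pe c x)%R by rewrite mulr_ge0 ?powpos_ge0 ?expR_ge0.
have mpe c : measurable_fun setT (pe c).
  by apply: measurable_funM; [exact: measurable_powpos|exact: measurable_expRN].
have empe c : measurable_fun [set: measurableTypeR R] (EFin \o pe c).
  by apply/measurable_EFinP; exact: mpe.
have msum : measurable_fun [set: n.-tuple R] (fun t => \sum_i tnth t i)%R.
  by apply: measurable_sum => i; exact: measurable_tnth.
pose K (z : n.-tuple R * measurableTypeR R) : \bar R :=
  (\prod_i powpos (a i) (tnth z.1 i) * powpos b (z.2 - \sum_i tnth z.1 i) *
    expR (- z.2))%:E.
have K0 z : 0 <= K z.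
  rewrite lee_fin mulr_ge0 ?expR_ge0 // mulr_ge0 ?powpos_ge0 //.
  by apply: prodr_ge0 => i _; exact: powpos_ge0.
have mprod : measurable_fun [set: n.-tuple R] (fun t => \prod_i powpos (a i) (tnth t i))%R.
  by apply: (measurable_prod_tnth (f := fun i => powpos (a i))) => i; exact: measurable_powpos.
have mK : measurable_fun setT K.
  apply/measurable_EFinP; apply: measurable_funM; last first.
    have mexp : measurable_fun [set: measurableTypeR R] (fun x : R => expR (- x)).
      exact: measurable_expRN.
    exact: (measurableT_comp mexp measurable_snd).
  apply: measurable_funM; first exact: (measurableT_comp mprod measurable_fst).
  apply: (measurableT_comp (measurable_powpos b)).
  apply: measurable_funB => //.
  exact: (measurableT_comp msum measurable_fst).
set F := fun t : n.-tuple R => _.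
have F0 t : 0 <= F t.
  rewrite lee_fin mulr_ge0 ?powpos_ge0 // prodr_ge0 // => i _; exact: powpos_ge0.
have mF : measurable_fun setT F.
  apply/measurable_EFinP; apply: measurable_funM => //.
  apply: (measurableT_comp (measurable_powpos b)).
  exact: measurable_funB.
transitivity (\int[m]_t \int[leb]_s K (t, s)).
  rewrite -(iter_integral_prod (f := fun i => pe (a i))) // -Hm; last 2 first.
  - by apply/measurable_EFinP; exact: (measurable_prod_tnth (f := fun i => pe (a i))).
  - by move=> t; rewrite lee_fin prodr_ge0.
  rewrite -ge0_integralZr //; last 3 first.
  - by apply/measurable_EFinP; exact: (measurable_prod_tnth (f := fun i => pe (a i))).
  - by move=> t _; rewrite lee_fin prodr_ge0.
  - exact/ltW/gamma_integral_gt0.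
  apply: eq_integral => t _.
  rewrite /gamma_integral -ge0_integralZl //; last 3 first.
  - exact: empe.
  - by move=> x _; rewrite lee_fin pe0.
  - by rewrite lee_fin prodr_ge0.
  rewrite -(ge0_integral_shift
    (f := fun x => (\prod_i pe (a i) (tnth t i))%:E * (pe b x)%:E)
    (- (\sum_i tnth t i))%R) /=; last 2 first.
  - exact: measurable_funeM (empe b).
  - by move=> x; rewrite mule_ge0 // lee_fin ?pe0 // prodr_ge0.
  apply: eq_integral => s _; rewrite /K /= -EFinM; congr EFin.
  rewrite /pe big_split /= -!mulrA; congr (_ * _)%R.
  rewrite mulrCA; congr (_ * _)%R.
  by rewrite -expR_sum -expRD sumrN opprB addrA addNr add0r.
rewrite fubini_tonelli // /gamma_integral -ge0_integralZr //; last 3 first.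
- exact: empe.
- by move=> x _; rewrite lee_fin pe0.
- exact: iter_integral_ge0.
(* For [s <= 0] both sides vanish: if all the [t_i] are positive, then [s - \sum_i t_i] is not. *)
apply: eq_integral => s _; case: (ltP 0%R s) => s0; last first.
  rewrite {1}/powpos ltNge s0 mul0r mul0e.
  apply: integral0_eq => t _; rewrite /K /=.
  have [t0|/forallPn[i ti]] := boolP [forall i, 0 < tnth t i]%R.
    rewrite [X in (_ * X * _)%R](_ : _ = 0%R) ?mulr0 ?mul0r // /powpos ifF //.
    apply/negbTE; rewrite -leNgt subr_le0 (le_trans s0) //.
    by apply: sumr_ge0 => i _; apply: ltW; exact: (forallP t0).
  by rewrite (bigD1 i) //= {1}/powpos (negbTE ti) !mul0r.
rewrite Hm //; last first.
  exact: (measurableT_comp mK (measurable_pair2 s)).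
rewrite (iter_integral_scale s0) //; last first.
  exact: (measurableT_comp mK (measurable_pair2 s)).
have -> : (fun t => K (map_tuple ( *%R s) t, s)) = (fun t =>
    (s `^ (\sum_i (a i - 1)%R) * s `^ (b - 1) * expR (- s))%:E * F t).
  apply/funext => t; rewrite /K /F /= -EFinM; congr EFin.
  under eq_bigr do rewrite tnth_map powposM //.
  rewrite big_split /= powR_sum //.
  under [X in (s - X)%R]eq_bigr do rewrite tnth_map.
  rewrite -mulr_sumr -[X in (X - _)%R]mulr1 -mulrBr powposM //.
  by rewrite [RHS]mulrAC; congr (_ * _)%R; exact: mulrACA.
rewrite iter_integralZl //; last by rewrite !mulr_ge0 ?powR_ge0 ?expR_ge0.
rewrite muleA -EFinM; congr (_%:E * _).
rewrite /powpos s0 !mulrA; congr (_ * _)%R.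
(* The Jacobian supplies one exponent 1 per coordinate, which turns each [a i - 1] into [a i]. *)
have -> : (s ^+ n = s `^ (\sum_(i < n) 1%R))%R.
  by rewrite sumr_const card_ord -powR_mulrn // ltW.
rewrite -!powRD ?(gt_eqF s0) ?implybT // -big_split /=; congr (_ `^ _)%R.
by rewrite addrA; congr (_ + _ - _)%R; apply: eq_bigr => i _; rewrite addrC subrK.
Qed.

End iter_integral_theory.

Section dirichlet_moment.
Context (R : realType) (n : nat) (alpha : 'I_n.+1 -> R).
Hypothesis alpha0 : forall i, 0 < alpha i.

Lemma simplex_point_widen (t : n.-tuple R) (i : 'I_n) :
  tnth (simplex_point (k := n.+1) t) (widen_ord (leqnSn n) i) = tnth t i.
Proof. by rewrite tnth_mktuple (tnth_nth (1 - \sum_(j < n) tnth t j)). Qed.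

Lemma simplex_point_max (t : n.-tuple R) :
  tnth (simplex_point (k := n.+1) t) ord_max = 1 - \sum_i tnth t i.
Proof. by rewrite tnth_mktuple nth_default // size_tuple. Qed.

Lemma dirichlet_densityE (x : n.+1.-tuple R) :
  dirichlet_density alpha x =
  gamma_fun (\sum_i alpha i) / (\prod_i gamma_fun (alpha i)) *
  \prod_i powpos (alpha i) (tnth x i).
Proof.
rewrite /dirichlet_density; case: ifPn => [x0|/forallPn[i xi]].
  by congr (_ * _); apply: eq_bigr => i _; rewrite /powpos (forallP x0).
by rewrite [X in _ * X](bigD1 i) //= {1}/powpos (negbTE xi) mul0r mulr0.
Qed.

Lemma measurable_simplex_point :
  measurable_fun [set: n.-tuple R] (simplex_point (k := n.+1)).
Proof.
apply/measurable_fun_tnthP => i.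
have [im|im] := eqVneq i ord_max.
  rewrite (_ : _ \o _ = fun t => 1 - \sum_i tnth t i); last first.
    by apply/funext => t; rewrite /= im simplex_point_max.
  apply: measurable_funB => //; apply: measurable_sum => j.
  exact: measurable_tnth.
have il : (i < n)%N by rewrite ltn_neqAle -ltnS ltn_ord andbT.
rewrite (_ : _ \o _ = fun t => tnth t (Ordinal il)); last first.
  by apply/funext => t; rewrite /= -simplex_point_widen; congr tnth; exact/val_inj.
exact: measurable_tnth.
Qed.

Lemma measurable_dirichlet_density :
  measurable_fun [set: n.+1.-tuple R] (dirichlet_density alpha).
Proof.
rewrite (funext dirichlet_densityE).
apply: measurable_funM => //.
apply: (measurable_prod_tnth (f := fun i => powpos (alpha i))) => i.
 exact: measurable_powpos.
Qed.

Lemma dirichlet_density_ge0 x : 0 <= dirichlet_density alpha x.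
Proof.
rewrite dirichlet_densityE mulr_ge0 ?prodr_ge0 // => [|i _]; last exact: powpos_ge0.
rewrite divr_ge0 ?prodr_ge0 // => [|i _]; apply/ltW/gamma_fun_gt0 => //.
rewrite (bigD1 ord0) //= ltr_wpDr ?sumr_ge0 // => i _; exact: ltW.
Qed.

(** Multiplying the density by a monomial shifts each parameter [alpha i] to [alpha i + e i], so the
    moment is a normalization integral for the shifted parameters. *)
Lemma dirichlet_moment (e : 'I_n.+1 -> nat) :
  iter_integral (fun t : n.-tuple R =>
    (dirichlet_density alpha (simplex_point (k := n.+1) t) *
     \prod_i tnth (simplex_point (k := n.+1) t) i ^+ e i)%:E) =
  ((\prod_i (gamma_fun (alpha i + (e i)%:R) / gamma_fun (alpha i))) /
   (gamma_fun (\sum_i (alpha i + (e i)%:R)) / gamma_fun (\sum_i alpha i)))%:E.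
Proof.
have sum0 (b : 'I_n.+1 -> R) : (forall i, 0 < b i) -> 0 < \sum_i b i.
  by move=> b0; rewrite (bigD1 ord0) //= ltr_wpDr ?sumr_ge0 // => i _; exact: ltW.
pose a i := alpha i + (e i)%:R.
have a0 i : 0 < a i by rewrite ltr_wpDr.
set C := gamma_fun (\sum_i alpha i) / (\prod_i gamma_fun (alpha i)).
have C0 : 0 <= C.
  by rewrite divr_ge0 ?prodr_ge0 // => [|i _]; apply/ltW/gamma_fun_gt0 => //; exact: sum0.
pose F (t : n.-tuple R) := (\prod_(i < n) powpos (a (widen_ord (leqnSn n) i)) (tnth t i) *
   powpos (a ord_max) (1 - \sum_i tnth t i))%:E.
have mF : measurable_fun setT F.
  apply/measurable_EFinP; apply: measurable_funM => //.
    apply: (measurable_prod_tnth (f := fun i => powpos (a (widen_ord (leqnSn n) i)))) => i.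
    exact: measurable_powpos.
  apply: (measurableT_comp (measurable_powpos _)).
  apply: measurable_funB => //.
  by apply: measurable_sum => i; exact: measurable_tnth.
have F0 t : (0 <= F t)%E.
  by rewrite lee_fin mulr_ge0 ?powpos_ge0 // prodr_ge0 // => i _; exact: powpos_ge0.
rewrite (_ : (fun t => _) = (fun t => C%:E * F t)%E); last first.
  apply/funext => t; rewrite /F -EFinM dirichlet_densityE -mulrA -/C; congr (_ * _)%:E.
  rewrite -big_split /= big_ord_recr /= simplex_point_max powposD; congr (_ * _).
  by apply: eq_bigr => i _; rewrite simplex_point_widen powposD.
rewrite iter_integralZl //.
have := dirichlet_normalization (fun i : 'I_n => a (widen_ord (leqnSn n) i)) (a ord_max).
rewrite -/F.
have -> : \sum_(i < n) a (widen_ord (leqnSn n) i) + a ord_max = \sum_i a i.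
  by rewrite big_ord_recr.
rewrite (eq_bigr _ (fun i _ => gamma_integralE (a0 (widen_ord (leqnSn n) i)))).
rewrite prodEFin !gamma_integralE ?sum0 // -EFinM.
have -> : \prod_(i < n) gamma_fun (a (widen_ord (leqnSn n) i)) * gamma_fun (a ord_max) =
    \prod_i gamma_fun (a i) by rewrite [RHS]big_ord_recr.
set D := iter_integral F => hD.
have g0 := gamma_fun_gt0 (sum0 _ a0).
(* In [hD] the left side is finite and the factor of [D] is positive, which excludes infinite values
   of [D]. *)
have -> : D = (\prod_i gamma_fun (a i) / gamma_fun (\sum_i a i))%:E.
  move: hD; case: D => [r| |] /=.
  - by rewrite -EFinM => -[->]; rewrite mulrC mulKf // gt_eqF.
  - by rewrite gt0_muley ?lte_fin.
  - by rewrite gt0_muleNy ?lte_fin.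
rewrite -EFinM prodf_div invf_div /C; congr EFin.
by rewrite mulrACA [RHS]mulrACA; congr (_ * _); exact: mulrC.
Qed.

End dirichlet_moment.

(** * Laws on the unit cube are determined by their moments *)

Section cutoff_polynomial.
Context (R : realType).

Lemma bernoulli_ineq (v : R) n : 0 <= v -> 1 + n%:R * v <= (1 + v) ^+ n.
Proof.
move=> v0; elim: n => [|n IH]; first by rewrite mul0r addr0 expr0.
rewrite exprS; apply: (@le_trans _ _ ((1 + v) * (1 + n%:R * v))).
  have : 0 <= n%:R * v * v by rewrite !mulr_ge0.
  by rewrite -natr1; nra.
by rewrite ler_wpM2l // addr_ge0.
Qed.

Lemma bernoulli_ineqB (v : R) n : 0 <= v <= 1 -> 1 - n%:R * v <= (1 - v) ^+ n.
Proof.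
move=> /andP[v0 v1]; elim: n => [|n IH]; first by rewrite mul0r subr0 expr0.
rewrite exprS; apply: (@le_trans _ _ ((1 - v) * (1 - n%:R * v))); last first.
  by rewrite ler_wpM2l // subr_ge0.
have : 0 <= n%:R * v * v by rewrite !mulr_ge0.
rewrite -natr1; nra.
Qed.

(** With [s] the mean of 1 and [r], one has [r <= s ^+ 2]. Hence [n * r ^ n] is at most
    [(n * s ^ n) * s ^ n], whose first factor is bounded by the Bernoulli inequality for [s^-1]. *)
Lemma cvg_natrMX (r : R) : 0 <= r < 1 -> n%:R * r ^+ n @[n --> \oo] --> 0.
Proof.
move=> /andP[r0 r1]; pose s := (1 + r) / 2.
have s0 : 0 < s by rewrite divr_gt0 // ltr_pwDl.
have s1 : s < 1 by rewrite ltr_pdivrMr // mul1r -natr1 addrC ltrD2r.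
have rs : r <= s ^+ 2.
  by rewrite -subr_ge0 (_ : _ - _ = ((1 - r) / 2) ^+ 2) ?sqr_ge0 // /s; field.
have h0 : 0 < s^-1 - 1 by rewrite subr_gt0 invf_gt1.
apply: (@squeeze_cvgr _ _ _ _ (fun=> 0) (fun n => (s^-1 - 1)^-1 * s ^+ n)).
- apply: nearW => n; rewrite mulr_ge0 ?exprn_ge0 //=.
  apply: (@le_trans _ _ (n%:R * (s ^+ n * s ^+ n))).
    by rewrite ler_wpM2l // -exprD addnn -mul2n exprM lerXn2r ?nnegrE // exprn_ge0 // ltW.
  rewrite mulrA ler_pM2r ?exprn_gt0 // -[leRHS]mul1r ler_pdivlMr //.
  have := bernoulli_ineq n (ltW h0); rewrite addrCA subrr addr0 => h.
  rewrite mulrAC -(@ler_pM2r _ (s^-1 ^+ n)) ?exprn_gt0 ?invr_gt0 //.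
  rewrite -[leLHS]mulrA -exprMn mulfV ?gt_eqF // expr1n mulr1 mul1r.
  by apply: le_trans h; rewrite lerDr.
- exact: cvg_cst.
- rewrite -[X in _ --> X](mulr0 (s^-1 - 1)^-1); apply: cvgMr.
  by apply: cvg_expr; rewrite ger0_norm // ltW.
Qed.

(* The exponent makes [exponent * u ^ n] tend to 0 for [u < x] and to infinity for
   [x <= u]. *)
Definition cutoff (x : R) (n : nat) : {poly R} :=
  if x <= 0 then 0 else if 1 < x then 1 else
  (1 - 'X^n) ^+ (Num.truncn (n.+1%:R / x ^+ n)).+1.

Lemma cutoff_itv x n (u : R) : 0 <= u <= 1 -> 0 <= (cutoff x n).[u] <= 1.
Proof.
move=> /andP[u0 u1]; rewrite /cutoff; case: ifP => _; first by rewrite horner0 lexx ler01.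
case: ifP => _; first by rewrite hornerE ler01 lexx.
rewrite !hornerE exprn_ge0 ?exprn_ile1 // ?subr_ge0 ?exprn_ile1 //.
by rewrite gerBl exprn_ge0.
Qed.

(** Write [K] for the exponent, about [(n + 1) / x ^ n]. If [u < x], the value is at least
    [1 - K * u ^ n], and [K * u ^ n] tends to 0. If [x <= u], it is at most [1 / (1 + u ^ n) ^ K],
    and the Bernoulli inequality bounds this by [1 / (n + 1)]. *)
Lemma cutoff_cvg x (u : R) : 0 <= u <= 1 ->
  (cutoff x n).[u] @[n --> \oo] --> ((u < x)%R%:R : R).
Proof.
move=> u01; have /andP[u0 u1] := u01; rewrite /cutoff.
case: (leP x 0) => x0.
  rewrite (_ : (fun n => _) = fun=> 0); last by apply/funext => n; rewrite horner0.
  by rewrite ltNge (le_trans x0 u0); exact: cvg_cst.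
case: (ltP 1 x) => x1.
  rewrite (_ : (fun n => _) = fun=> 1); last by apply/funext => n; rewrite hornerE.
  by rewrite (le_lt_trans u1 x1); exact: cvg_cst.
set K := fun n => (Num.truncn (n.+1%:R / x ^+ n)).+1.
have xn0 n : 0 < x ^+ n by rewrite exprn_gt0.
have K_gt n : n.+1%:R / x ^+ n < (K n)%:R by exact: truncnS_gt.
have K_le n : (K n)%:R <= n.+1%:R / x ^+ n + 1.
  by rewrite /K -natr1 lerD2r truncn_le // divr_ge0 // ltW.
have E n : ((1 - 'X^n) ^+ K n).[u] = (1 - u ^+ n) ^+ K n by rewrite !hornerE.
under eq_fun do rewrite -/(K _) E.
case: ltP => ux.
  have r01 : 0 <= u / x < 1 by rewrite divr_ge0 ?(ltW x0) // ltr_pdivrMr // mul1r.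
  apply: (@squeeze_cvgr _ _ _ _
      (fun n => 1 - (n%:R * (u / x) ^+ n + (u / x) ^+ n + u ^+ n)) (fun=> 1)).
  - apply: nearW => n.
    have un01 : 0 <= u ^+ n <= 1 by rewrite exprn_ge0 ?exprn_ile1.
    rewrite exprn_ile1 ?andbT ?subr_ge0 ?gerBl; try by case/andP: un01.
    apply: le_trans (bernoulli_ineqB _ un01); rewrite lerD2l lerN2.
    apply: (@le_trans _ _ ((n.+1%:R / x ^+ n + 1) * u ^+ n)).
      by rewrite ler_wpM2r //; case/andP: un01.
    rewrite mulrDl mul1r lerD2r -natr1 -mulrA [_^-1 * _]mulrC -expr_div_n.
    by rewrite mulrDl mul1r.
  - rewrite -[X in _ --> X](subr0 1); apply: cvgB; first exact: cvg_cst.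
    rewrite -[X in _ --> X](addr0 0); apply: cvgD; last first.
      by apply: cvg_expr; rewrite ger0_norm // (lt_le_trans ux).
    rewrite -[X in _ --> X](addr0 0); apply: cvgD; first exact: cvg_natrMX.
    by case/andP: r01 => ? ?; apply: cvg_expr; rewrite ger0_norm.
  - exact: cvg_cst.
apply: (@squeeze_cvgr _ _ _ _ (fun=> 0) (@harmonic R)).
- apply: nearW => n.
  have un01 : 0 <= u ^+ n <= 1 by rewrite exprn_ge0 ?exprn_ile1.
  have /andP[un0 un1] := un01.
  rewrite exprn_ge0 ?subr_ge0 //= /harmonic.
  have h1 : n.+1%:R <= (1 + u ^+ n) ^+ K n.
    apply: le_trans (bernoulli_ineq _ un0).
    apply: (@le_trans _ _ ((K n)%:R * x ^+ n)).
      by rewrite -ler_pdivrMr // ltW.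
    apply: (@le_trans _ _ ((K n)%:R * u ^+ n)); last by rewrite lerDr.
    by rewrite ler_wpM2l // lerXn2r ?nnegrE // ltW.
  rewrite -[leRHS]mul1r ler_pdivlMr //.
  (* The product is [(1 - u ^ (2 n)) ^ K], which is at most 1. *)
  apply: (@le_trans _ _ ((1 - u ^+ n) ^+ K n * (1 + u ^+ n) ^+ K n)).
    by rewrite ler_wpM2l // exprn_ge0 // subr_ge0.
  rewrite -exprMn -subr_sqr expr1n exprn_ile1 // ?subr_ge0 ?gerBl ?sqr_ge0 //.
  by rewrite exprn_ile1.
- exact: cvg_cst.
- exact: cvg_harmonic.
Qed.

Lemma cvg_prodr (I : Type) (r : seq I) (f : I -> nat -> R) (l : I -> R) :
  (forall i, f i n @[n --> \oo] --> l i) ->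
  \prod_(i <- r) f i n @[n --> \oo] --> \prod_(i <- r) l i.
Proof.
move=> fl; elim: r => [|i r IH].
  by rewrite big_nil; under eq_fun do rewrite big_nil; exact: cvg_cst.
by rewrite big_cons; under eq_fun do rewrite big_cons; exact: cvgM.
Qed.

End cutoff_polynomial.

Section weighted_law.
Context (d : measure_display) (T : measurableType d) (R : realType) (k : nat).
Variables (m : {measure set T -> \bar R}) (w : T -> R) (X : T -> k.-tuple R).
Hypotheses (w0 : forall t, 0 <= w t) (mw : measurable_fun setT w)
  (mX : measurable_fun setT X).
Local Open Scope ereal_scope.

(** The law of [X] under the measure with density [w]. It covers the law of a floret vector
    ([w = 1]) and the Dirichlet law ([X] the map [simplex_point], [w] the density). Further down,
    [X] is confined to the cube only where [w] is nonzero, because [simplex_point] leaves it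
    elsewhere. *)
Definition weighted_law (A : set (k.-tuple R)) : \bar R :=
  \int[m]_(t in X @^-1` A) (w t)%:E.

Let measurable_preimage (A : set (k.-tuple R)) : measurable A -> measurable (X @^-1` A).
Proof. by move=> mA; rewrite -[X in measurable X]setTI; exact: mX. Qed.

Lemma weighted_lawE A : measurable A ->
  weighted_law A = \int[m]_t (w t * \1_A (X t))%:E.
Proof.
move=> mA; rewrite /weighted_law integral_mkcond; apply: eq_integral => t _.
rewrite patchE indicE (_ : (t \in X @^-1` A) = (X t \in A)); last first.
  by apply/idP/idP; rewrite !inE.
by case: ifPn; rewrite ?mulr1 ?mulr0.
Qed.

Let weighted_law0 : weighted_law set0 = 0.
Proof. by rewrite /weighted_law preimage_set0 integral_set0. Qed.

Let weighted_law_ge0 A : 0 <= weighted_law A.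
Proof. by apply: integral_ge0 => t _; rewrite lee_fin. Qed.

Let weighted_law_sigma_additive : semi_sigma_additive weighted_law.
Proof.
move=> F mF tF mUF; rewrite /weighted_law preimage_bigcup ge0_integral_bigcup //.
- by apply: is_cvg_ereal_nneg_natsum_cond => n _ _; exact: weighted_law_ge0.
- by move=> i; exact: measurable_preimage.
- by apply/measurable_EFinP; exact: measurable_funTS.
- by move=> t _; rewrite lee_fin.
- apply/trivIsetP => i j _ _ ij; rewrite -preimage_setI.
  by move/trivIsetP : tF => /(_ _ _ _ _ ij) ->//; rewrite preimage_set0.
Qed.

HB.instance Definition _ := isMeasure.Build _ _ _ weighted_law
  weighted_law0 weighted_law_ge0 weighted_law_sigma_additive.

Definition weighted_law_measure : {measure set (k.-tuple R) -> \bar R} := weighted_law.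

Definition tuple_moment (e : 'I_k -> nat) : \bar R :=
  \int[m]_t (w t * \prod_i tnth (X t) i ^+ e i)%:E.

Hypotheses (iw : m.-integrable setT (EFin \o w))
  (X01 : forall t i, w t != 0%R -> (0 <= tnth (X t) i <= 1)%R).

Let mXi i : measurable_fun setT (fun t => tnth (X t) i).
Proof. by move/measurable_fun_tnthP : mX => /(_ i). Qed.

Let integrable_bounded (g : T -> R) : measurable_fun setT g ->
  (forall t, w t != 0%R -> (0 <= g t <= 1)%R) ->
  m.-integrable setT (fun t => (w t * g t)%:E).
Proof.
move=> mg g01; apply: le_integrable iw => //.
  by apply/measurable_EFinP; exact: measurable_funM.
move=> t _ /=; rewrite lee_fin normrM.
have [-> |/g01 /andP[g0 g1]] := eqVneq (w t) 0%R; first by rewrite normr0 mul0r.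
by rewrite ler_piMr // ger0_norm.
Qed.

(** Expanding the product leaves monomials only. The common bound [N] lets one finite type index all
    exponent vectors. *)
Lemma integral_prod_horner (p : 'I_k -> {poly R}) N :
  (forall i, (size (p i) <= N)%N) ->
  \int[m]_t (w t * \prod_i (p i).[tnth (X t) i])%:E =
  \sum_(f : {ffun 'I_k -> 'I_N}) (\prod_i (p i)`_(f i))%:E * tuple_moment (fun i => f i).
Proof.
move=> pN.
have im (f : {ffun 'I_k -> 'I_N}) :
    m.-integrable setT (fun t => (w t * \prod_i tnth (X t) i ^+ f i)%:E).
  apply: integrable_bounded.
    by apply: measurable_prod => i _; exact: measurable_funX.
  move=> t wt; rewrite prodr_ge0 ?prodr_ile1 // => i _; have /andP[h0 h1] := X01 i wt.
    by rewrite exprn_ge0 // exprn_ile1.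
  by rewrite exprn_ge0.
transitivity (\int[m]_t \sum_(f : {ffun 'I_k -> 'I_N})
    ((\prod_i (p i)`_(f i))%:E * (w t * \prod_i tnth (X t) i ^+ f i)%:E)).
  apply: eq_integral => t _.
  rewrite (eq_bigr (fun i => \sum_(j < N) (p i)`_j * tnth (X t) i ^+ j)%R); last first.
    by move=> i _; exact: horner_coef_wide.
  rewrite bigA_distr_bigA /= mulr_sumr -sumEFin; apply: eq_bigr => f _.
  by rewrite -EFinM big_split /= mulrCA.
rewrite integral_sum //; last by move=> f; exact: integrableZl.
by apply: eq_bigr => f _; rewrite integralZl.
Qed.

(** These orthants are unbounded below: they are stable under intersection, and their indicators are
    products of the limits of [cutoff]. *)
Definition box (c : 'I_k -> R) : set (k.-tuple R) :=
  [set x | forall i, (tnth x i < c i)%R].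

Lemma indic_box c x : \1_(box c) x = (\prod_i (tnth x i < c i)%R%:R)%R :> R.
Proof.
rewrite indicE; case: (boolP (x \in box c)).
  by rewrite inE => h; rewrite big1 // => i _; rewrite h.
move=> /negP h; have [i ci] : exists i, ~~ (tnth x i < c i)%R.
  apply: contrapT => h'; apply: h; rewrite inE => i.
  by apply: contrapT => /negP xi; apply: h'; exists i.
by rewrite (bigD1 i) //= (negbTE ci) mul0r.
Qed.

Lemma measurable_box c : measurable (box c).
Proof.
have -> : box c = \bigcap_(i in [set: 'I_k])
    ((fun x : k.-tuple R => tnth x i) @^-1` `]-oo, c i[).
  apply/seteqP; split => x /=; first by move=> h i _ /=; rewrite in_itv /=.
  by move=> h i; have := h i I; rewrite /= in_itv.
apply: fin_bigcap_measurable => // i _.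
rewrite -[X in measurable X]setTI; apply: measurable_tnth => //; exact: measurable_itv.
Qed.

Lemma weighted_law_box_cvg c :
  \int[m]_t (w t * \prod_i (cutoff (c i) n).[tnth (X t) i])%:E @[n --> \oo] -->
  weighted_law (box c).
Proof.
rewrite weighted_lawE; last exact: measurable_box.
have mh (p : {poly R}) i : measurable_fun setT (fun t => p.[tnth (X t) i]).
  apply: (measurableT_comp (f := fun x => p.[x])) => //.
  apply: continuous_measurable_fun; exact: continuous_horner.
have bounded n t : w t != 0%R ->
    (0 <= \prod_i (cutoff (c i) n).[tnth (X t) i] <= 1)%R.
  move=> wt; apply/andP; split; [apply: prodr_ge0|apply: prodr_ile1] => i _;
    by have /andP[h h'] := cutoff_itv (c i) n (X01 i wt); rewrite ?h.
have [] // := @dominated_convergence _ _ _ m setT measurableT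
  (fun n t => (w t * \prod_i (cutoff (c i) n).[tnth (X t) i])%:E)
  (fun t => (w t * \1_(box c) (X t))%:E) (EFin \o w).
- move=> n; apply/measurable_EFinP; apply: measurable_funM => //.
  by apply: measurable_prod => i _; exact: mh.
- apply/measurable_EFinP; apply: measurable_funM => //.
  exact: (measurableT_comp (measurable_indic (measurable_box c)) mX).
- apply: aeW => t _; apply: cvg_EFin; first exact: nearW.
  have [-> |wt] := eqVneq (w t) 0%R.
    rewrite mul0r; under eq_fun do rewrite mul0r.
    exact: cvg_cst.
  apply: cvgM; first exact: cvg_cst.
  rewrite indic_box; apply: cvg_prodr => i; apply: cutoff_cvg; exact: X01.
- apply: aeW => t n _ /=; rewrite lee_fin normrM (ger0_norm (w0 t)).
  have [-> |/(bounded n) /andP[g0 g1]] := eqVneq (w t) 0%R; first by rewrite mul0r.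
  by rewrite ler_piMr // ger0_norm.
Qed.

End weighted_law.

Lemma box_generates (R : realType) (k : nat) :
  @measurable _ (k.-tuple R) = <<s [set box c | c in [set: 'I_k -> R]] >>.
Proof.
apply/seteqP; split; last first.
  apply: smallest_sub; first exact: sigma_algebra_measurable.
  by move=> _ [c _ <-]; exact: measurable_box.
set G := [set box c | c in _].
have coord i (B : set R) : measurable B -> <<s G >> ((fun x : k.-tuple R => tnth x i) @^-1` B).
  pose H := [set B : set R | <<s G >> ((fun x : k.-tuple R => tnth x i) @^-1` B)].
  have sH : sigma_algebra setT H.
    split.
    - by rewrite /H /= preimage_set0; exact: sigma_algebra0.
    - by move=> A HA; rewrite /H /= setTD preimage_setC; exact: sigma_algebraC.
    - by move=> F HF; rewrite /H /= preimage_bigcup; exact: sigma_algebra_bigcup.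
  have : <<s @RGenInftyO.G R >> `<=` H.
    apply: smallest_sub => // _ [x ->]; rewrite /H /=.
    (* A half-space in one coordinate is exhausted by boxes whose other bounds grow. *)
    rewrite (_ : _ @^-1` _ = \bigcup_n box (fun j => if j == i then x else n%:R)).
      apply: sigma_algebra_bigcup => n; apply: sub_sigma_algebra.
      by exists (fun j => if j == i then x else n%:R).
    apply/seteqP; split => t /=; last first.
      by move=> [n _ /(_ i)]; rewrite eqxx in_itv.
    rewrite in_itv /= => ti.
    exists (Num.bound (\sum_j `|tnth t j|)) => // j.
    case: eqP => [-> //|_].
    apply: le_lt_trans (archi_boundP _); last by rewrite sumr_ge0.
    apply: le_trans (ler_norm _) _.
    by rewrite (bigD1 j) //= lerDl sumr_ge0.
  move=> GH mB; apply: (GH B).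
  have <- : (@ocitv R).-sigma.-measurable = <<s @RGenInftyO.G R >>.
    by rewrite RGenInftyO.measurableE.
  exact: mB.
apply: smallest_sub; first exact: smallest_sigma_algebra.
by move=> A; rewrite -bigcup_seq => -[i _ [B mB <-]]; rewrite setTI; exact: coord.
Qed.

Section weighted_law_unique.
Context (R : realType) (k : nat)
  (d1 : measure_display) (T1 : measurableType d1) (m1 : {measure set T1 -> \bar R})
  (w1 : T1 -> R) (X1 : T1 -> k.-tuple R)
  (d2 : measure_display) (T2 : measurableType d2) (m2 : {measure set T2 -> \bar R})
  (w2 : T2 -> R) (X2 : T2 -> k.-tuple R).
Hypotheses (w10 : forall t, 0 <= w1 t) (mw1 : measurable_fun setT w1)
  (mX1 : measurable_fun setT X1) (iw1 : m1.-integrable setT (EFin \o w1))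
  (X101 : forall t i, w1 t != 0%R -> (0 <= tnth (X1 t) i <= 1)%R).
Hypotheses (w20 : forall t, 0 <= w2 t) (mw2 : measurable_fun setT w2)
  (mX2 : measurable_fun setT X2) (iw2 : m2.-integrable setT (EFin \o w2))
  (X201 : forall t i, w2 t != 0%R -> (0 <= tnth (X2 t) i <= 1)%R).

(** Integrals of products of polynomials depend on the moments alone. Their limits give equal masses
    to all boxes, a generating family stable under intersection. *)
Lemma weighted_law_unique :
  (forall e, tuple_moment m1 w1 X1 e = tuple_moment m2 w2 X2 e) ->
  forall A, measurable A -> weighted_law m1 w1 X1 A = weighted_law m2 w2 X2 A.
Proof.
move=> mom A mA.
have boxE c : weighted_law m1 w1 X1 (box c) = weighted_law m2 w2 X2 (box c).
  have lim1 := weighted_law_box_cvg w10 mw1 mX1 iw1 X101 (c := c).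
  have lim2 := weighted_law_box_cvg w20 mw2 mX2 iw2 X201 (c := c).
  suff e : (fun n => \int[m1]_t (w1 t * \prod_i (cutoff (c i) n).[tnth (X1 t) i])%:E)%E =
      (fun n => \int[m2]_t (w2 t * \prod_i (cutoff (c i) n).[tnth (X2 t) i])%:E)%E.
    by rewrite e in lim1; exact: (cvg_unique _ lim1 lim2).
  apply/funext => n.
  (* The sum of the sizes serves as common degree bound. *)
  have sz i : (size (cutoff (c i) n) <= \sum_i size (cutoff (c i) n))%N.
    by rewrite (bigD1 i) //= leq_addr.
  rewrite (integral_prod_horner mw2 mX2 iw2 X201 sz).
  rewrite (integral_prod_horner mw1 mX1 iw1 X101 sz).
  by apply: eq_bigr => f _; rewrite mom.
have := @measure_unique _ R (k.-tuple R) [set box c | c in [set: 'I_k -> R]]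
  (fun n => box (fun=> n%:R)) (box_generates R k) _ _ _
  (weighted_law_measure m1 w10 mw1 mX1) (weighted_law_measure m2 w20 mw2 mX2).
apply => //.
- move=> _ _ [c _ <-] [c' _ <-]; exists (fun i => Num.min (c i) (c' i)) => //.
  apply/seteqP; split => x /=.
    by move=> h; split => i; have := h i; rewrite lt_min => /andP[].
  by move=> [h h'] i; rewrite lt_min h h'.
- apply/seteqP; split => // x _.
  exists (Num.bound (\sum_j `|tnth x j|)) => // j.
  apply: le_lt_trans (archi_boundP _); last by rewrite sumr_ge0.
  apply: le_trans (ler_norm _) _.
  by rewrite (bigD1 j) //= lerDl sumr_ge0.
- by move=> _ [c _ <-]; exact: boxE.
- move=> n; have /integrableP[_ ] := iw1.
  apply: le_lt_trans; rewrite /= weighted_lawE //; last exact: measurable_box.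
  apply: ge0_le_integral => //.
  - by move=> t _; rewrite lee_fin mulr_ge0.
  - apply/measurable_EFinP; apply: measurable_funM => //.
    exact: (measurableT_comp (measurable_indic (measurable_box _)) mX1).
  - by apply/measurable_EFinP; exact: measurableT_comp.
  - move=> t _ /=; rewrite lee_fin ger0_norm // ler_piMr //.
Qed.

End weighted_law_unique.

(** * Independence *)

Section pairwise_independence.
Context (d : measure_display) (Omega : measurableType d) (R : realType)
  (P : probability Omega R).
Local Open Scope ereal_scope.

(** For fixed [F] both sides are finite measures in [E]. They agree on [G], which is stable under
    intersection, hence on the sigma-algebra it generates. *)
Lemma sigma_algebra_indep_event (G : set (set Omega)) (F : set Omega) :
  G `<=` measurable -> setI_closed G -> G setT -> measurable F ->
  (forall E, G E -> P (E `&` F) = P E * P F) ->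
  forall E, <<s G >> E -> P (E `&` F) = P E * P F.
Proof.
move=> Gm GI GT mF GF E sE.
have PF0 : (0 <= fine (P F))%R by exact: fine_ge0.
have := @g_sigma_algebra_measure_unique _ R Omega G Gm (fun=> setT) _ _
  (mrestr P mF) (mscale (NngNum PF0) P) GI.
rewrite /= /mrestr /mscale /= => H.
rewrite H //.
- by rewrite fineK ?fin_num_measure // muleC.
- by apply/seteqP; split => // x _; exists 0%N.
- by move=> A GA; rewrite GF // fineK ?fin_num_measure // muleC.
- by move=> _; rewrite -ge0_fin_numE // fin_num_measure //; exact: measurableI.
Qed.

Lemma sigma_algebra_indep (G H : set (set Omega)) :
  G `<=` measurable -> setI_closed G -> G setT ->
  H `<=` measurable -> setI_closed H -> H setT ->
  (forall E F, G E -> H F -> P (E `&` F) = P E * P F) ->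
  forall E F, <<s G >> E -> <<s H >> F -> P (E `&` F) = P E * P F.
Proof.
move=> Gm GI GT Hm HI HT GH E F sE sF.
have mF : measurable F by exact: (smallest_sub (@sigma_algebra_measurable _ _) Hm).
apply: (sigma_algebra_indep_event Gm) => // {sE}E GE.
rewrite setIC muleC; apply: (sigma_algebra_indep_event Hm) => //; first exact: Gm.
by move=> {mF sF}F HF; rewrite setIC muleC GH.
Qed.

Section joint_law.
Variables (f g : {RV P >-> R}).
Hypothesis fg : independent2 P f g.

Lemma independent2_joint_law (B : set (R * R)) : measurable B ->
  P ((fun x => (f x, g x)) @^-1` B) =
  (distribution P f \x distribution P g) B.
Proof.
move=> mB.
have mfg : measurable_fun setT (fun x : Omega => (f x, g x)).
  by apply: measurable_fun_pair.
pose m' := measure_function_pushforward__canonical__measure_function_Measure P mfg.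
have H := @product_measure_unique _ _ _ _ R (distribution P f) (distribution P g) m'.
by rewrite (H _ B mB).
Qed.

Lemma independent2_expectationM : (forall x, (0 <= f x)%R) -> (forall x, (0 <= g x)%R) ->
  \int[P]_x (f x * g x)%:E = \int[P]_x (f x)%:E * \int[P]_x (g x)%:E.
Proof.
move=> f0 g0.
have mfg : measurable_fun setT (fun x : Omega => (f x, g x)).
  by apply: measurable_fun_pair.
(* [h] is cut off so as to be nonnegative on the whole plane. *)
pose c (x : R) := Num.max x 0%R.
have c0 x : (0 <= c x)%R by rewrite le_max lexx orbT.
have mc : measurable_fun setT c by exact: measurable_maxr.
have cE x : (0 <= x)%R -> c x = x by move=> x0; apply/max_idPl.
pose h (z : R * R) := (c z.1 * c z.2)%:E.
have mh : measurable_fun setT h.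
  apply/measurable_EFinP; apply: measurable_funM.
    exact: (measurableT_comp mc measurable_fst).
  exact: (measurableT_comp mc measurable_snd).
have h0 z : 0 <= h z by rewrite lee_fin mulr_ge0.
transitivity (\int[pushforward P (fun x => (f x, g x))]_z h z).
  rewrite (ge0_integral_pushforward mfg P (f := h) measurableT) //.
  by apply: eq_integral => x _; rewrite /h /= !cE.
transitivity (\int[distribution P f \x distribution P g]_z h z).
  by apply: eq_measure_integral => B mB _; exact: independent2_joint_law.
rewrite fubini_tonelli1 // /fubini_F /h /=.
have intE (k : {RV P >-> R}) : (forall x, (0 <= k x)%R) ->
    \int[distribution P k]_x (c x)%:E = \int[P]_x (k x)%:E.
  move=> k0; rewrite ge0_integral_distribution //.
  - by apply: eq_integral => x _; rewrite /= cE.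
  - exact/measurable_EFinP.
rewrite -!intE // -ge0_integralZr //; last 3 first.
- exact/measurable_EFinP.
- by move=> x _; rewrite lee_fin.
- by apply: integral_ge0 => x _; rewrite lee_fin.
apply: eq_integral => x _; rewrite -ge0_integralZl //.
- exact/measurable_EFinP.
- by move=> y _; rewrite lee_fin.
- by rewrite lee_fin.
Qed.

End joint_law.

(** By Fubini: once [g] has the value [x], the sum is [c] only if [f] is the single value
    [c - x]. *)
Lemma independent2_add_atomless (f g : {RV P >-> R}) (c : R) : independent2 P f g ->
  (forall x, distribution P f [set x] = 0) ->
  P ((fun x => f x + g x)%R @^-1` [set c]) = 0.
Proof.
move=> fg fx0; have gf : independent2 P g f.
  by move=> A B mA mB; rewrite setIC muleC; exact: fg.
have mB : measurable [set z : R * R | (z.1 + z.2 = c)%R].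
  have mD : measurable_fun [set: R * R] (fun z : R * R => (z.1 + z.2)%R).
    exact: measurable_funD.
  by have := mD measurableT [set c] (measurable_set1 c); rewrite setTI.
(* The variables are swapped because [product_measure1] measures sections with the second law, which
   has to be that of [f]. *)
rewrite (_ : _ @^-1` _ =
    (fun x => (g x, f x)) @^-1` [set z : R * R | (z.1 + z.2 = c)%R]); last first.
  by apply/seteqP; split => x /=; rewrite addrC.
rewrite (independent2_joint_law gf mB) /product_measure1.
apply: integral0_eq => x _ /=.
rewrite (_ : xsection _ x = [set (c - x)%R]) //.
apply/seteqP; split => y; rewrite /xsection /= inE /=.
  by move=> <-; rewrite addrC addKr.
by move=> ->; rewrite addrC subrK.
Qed.

(** Restated for bare functions, since the products and sums met later are not declared as random
    variables. *)
Lemma independent2_integralM (f g : Omega -> R) :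
  measurable_fun setT f -> measurable_fun setT g -> independent2 P f g ->
  (forall x, (0 <= f x)%R) -> (forall x, (0 <= g x)%R) ->
  \int[P]_x (f x * g x)%:E = \int[P]_x (f x)%:E * \int[P]_x (g x)%:E.
Proof.
move=> mf mg; pose fM := isMeasurableFun.Build _ _ _ _ f mf.
pose gM := isMeasurableFun.Build _ _ _ _ g mg.
pose fRV : {RV P >-> R} := HB.pack f fM.
pose gRV : {RV P >-> R} := HB.pack g gM.
exact: (@independent2_expectationM fRV gRV).
Qed.

Lemma integral_probability_cst (r : R) : \int[P]_x r%:E = r%:E.
Proof.
by rewrite integral_cst // -[RHS]mule1; congr (_ * _); exact: probability_setT.
Qed.

Lemma ge0_expectation_gt0 (f : Omega -> R) : measurable_fun setT f ->
  (forall x, (0 <= f x)%R) -> P (f @^-1` [set 0%R]) = 0 -> 0 < \int[P]_x (f x)%:E.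
Proof.
move=> mf f0 Pf0; rewrite lt0e integral_ge0 ?andbT; last first.
  by move=> x _; rewrite lee_fin.
apply/eqP => h.
have mef : measurable_fun setT (EFin \o f) by exact/measurable_EFinP.
have : \int[P]_(x in setT) `|(EFin \o f) x| = 0.
  by rewrite -h; apply: eq_integral => x _ /=; rewrite ger0_norm.
move/(ae_eq_integral_abs P measurableT mef).1 => [N [mN N0 sub]].
have mZ : measurable (f @^-1` [set 0%R]).
  by rewrite -[X in measurable X]setTI; exact: mf.
have : P setT <= P (f @^-1` [set 0%R]) + P N.
  apply: le_trans (measureU2 _ mZ mN); apply: le_measure; rewrite ?inE //.
    exact: measurableU.
  move=> x _; have [fx|fx] := pselect (f x = 0%R); first by left.
  by right; apply: sub => /= /(_ I) -[].
by rewrite Pf0 N0 adde0 probability_setT lee_fin ler10.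
Qed.

End pairwise_independence.

(** * Sigma-algebras generated by subfamilies of independent variables *)

Section generated_sigma_algebra.
Context (d : measure_display) (Omega : measurableType d) (R : realType)
  (P : probability Omega R) (I : finType) (X : I -> Omega -> R).
Hypothesis mX : forall i, measurable_fun setT (X i).
Local Open Scope ereal_scope.

Definition rectangles (L : {set I}) : set (set Omega) :=
  [set E | exists2 A : I -> set R, (forall i, measurable (A i)) &
    E = \bigcap_(i in [set` L]) (X i @^-1` A i)].

Lemma rectangles_measurable L : rectangles L `<=` measurable.
Proof.
move=> _ [A mA ->]; apply: fin_bigcap_measurable => // i _.
by rewrite -[Y in measurable Y]setTI; exact: mX.
Qed.

Lemma rectangles_setI L : setI_closed (rectangles L).
Proof.
move=> _ _ [A mA ->] [B mB ->]; exists (fun i => A i `&` B i).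
  by move=> i; exact: measurableI.
apply/seteqP; split => x /=; first by move=> [hA hB] i iL; split; [exact: hA|exact: hB].
by move=> h; split => i iL; have [] := h i iL.
Qed.

Lemma rectangles_setT L : rectangles L setT.
Proof. by exists (fun=> setT) => //; apply/seteqP; split. Qed.

Lemma rectangles_sub (L M : {set I}) : L \subset M -> rectangles L `<=` rectangles M.
Proof.
move=> LM _ [A mA ->]; exists (fun i => if i \in L then A i else setT).
  by move=> i; case: ifP.
apply/seteqP; split => x /= h i /= iL; have := h i; first by move=> hi; case: ifP.
by move=> /= /(_ (fintype.subsetP LM _ iL)); rewrite iL.
Qed.

Definition generated (L : {set I}) : set (set Omega) := <<s rectangles L >>.

Lemma generated_measurable L : generated L `<=` measurable.
Proof.
apply: smallest_sub; first exact: sigma_algebra_measurable.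
exact: rectangles_measurable.
Qed.

Lemma generated_sub (L M : {set I}) : L \subset M -> generated L `<=` generated M.
Proof. by move=> LM; apply: sub_sigma_algebra2; exact: rectangles_sub. Qed.

Lemma generatedI L E F : generated L E -> generated L F -> generated L (E `&` F).
Proof. exact: (@measurableI _ (g_sigma_algebraType (rectangles L))). Qed.

Lemma generatedT L : generated L setT.
Proof. exact: (@measurableT _ (g_sigma_algebraType (rectangles L))). Qed.

(** A function of the variables [X i] with [i] in [L]. Measurability on a generated type makes the
    usual closure lemmas for sums and products available. *)
Definition adapted (L : {set I}) (d' : measure_display) (T : measurableType d')
    (f : Omega -> T) : Prop :=
  measurable_fun [set: g_sigma_algebraType (rectangles L)] f.

Lemma adapted_generated L d' (T : measurableType d') (f : Omega -> T) B :
  adapted L f -> measurable B -> generated L (f @^-1` B).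
Proof. by move=> fL mB; rewrite -[Y in generated _ Y]setTI; exact: fL. Qed.

Lemma adapted_measurable L d' (T : measurableType d') (f : Omega -> T) :
  adapted L f -> measurable_fun setT f.
Proof.
move=> fL _ B mB; rewrite setTI; apply: (@generated_measurable L).
exact: adapted_generated.
Qed.

Lemma adapted_sub (L M : {set I}) d' (T : measurableType d') (f : Omega -> T) :
  L \subset M -> adapted L f -> adapted M f.
Proof. by move=> LM fL _ B mB; apply: (generated_sub LM); exact: fL. Qed.

Lemma adapted_coordinate i (L : {set I}) : i \in L -> adapted L (X i).
Proof.
move=> iL _ B mB; rewrite setTI; apply: sub_sigma_algebra.
exists (fun j => if j == i then B else setT); first by move=> j; case: ifP.
apply/seteqP; split => x /=; last by move=> /(_ i iL); rewrite eqxx.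
by move=> h j _; case: eqP => [->|].
Qed.

Hypothesis indepX : mutually_independent P [set: I]%SET X.

Lemma rectangles_indep (L M : {set I}) E F : [disjoint L & M]%B ->
  rectangles L E -> rectangles M F -> P (E `&` F) = P E * P F.
Proof.
move=> LM [A mA ->] [B mB ->].
(* As [L] and [M] are disjoint, the two families of constraints merge into one over their union. *)
pose C i := if i \in L then A i else B i.
have mC i : measurable (C i) by rewrite /C; case: ifP.
have -> : \bigcap_(i in [set` L]) (X i @^-1` A i) =
          \bigcap_(i in [set` L]) (X i @^-1` C i).
  by apply: eq_bigcapr => i /= iL; rewrite /C iL.
have -> : \bigcap_(i in [set` M]) (X i @^-1` B i) =
          \bigcap_(i in [set` M]) (X i @^-1` C i).
  by apply: eq_bigcapr => i /= iM; rewrite /C (disjointFl LM iM).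
have -> : \bigcap_(i in [set` L]) (X i @^-1` C i) `&`
    \bigcap_(i in [set` M]) (X i @^-1` C i) =
    \bigcap_(i in [set` (L :|: M)%SET]) (X i @^-1` C i).
  rewrite -bigcap_setU; congr bigcap; apply/seteqP; split => i /=.
    by move=> [iL|iM]; rewrite inE ?iL ?iM ?orbT.
  by rewrite inE => /orP.
rewrite !indepX ?finset.subsetT //.
rewrite (bigID (mem L)) /=; congr (_ * _); apply: eq_bigl => i; rewrite inE.
  by case: (i \in L); rewrite ?andbF.
by case: (boolP (i \in L)) => iL /=; rewrite ?andbT // (disjointFr LM iL).
Qed.

Lemma generated_indep (L M : {set I}) E F : [disjoint L & M]%B ->
  generated L E -> generated M F -> P (E `&` F) = P E * P F.
Proof.
move=> LM; apply: sigma_algebra_indep.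
- exact: rectangles_measurable.
- exact: rectangles_setI.
- exact: rectangles_setT.
- exact: rectangles_measurable.
- exact: rectangles_setI.
- exact: rectangles_setT.
- by move=> ? ?; exact: rectangles_indep.
Qed.

Lemma adapted_independent2 (L M : {set I}) d1 d2
    (T1 : measurableType d1) (T2 : measurableType d2)
    (f : Omega -> T1) (g : Omega -> T2) : [disjoint L & M]%B ->
  adapted L f -> adapted M g -> independent2 P f g.
Proof.
by move=> LM fL gM A B mA mB; apply: (generated_indep LM); exact: adapted_generated.
Qed.

Section blocks.
Variables (W : eqType) (L : W -> {set I}) (s : seq W).
Hypotheses (us : uniq s)
  (Ldisj : {in s &, forall v w, v != w -> [disjoint L v & L w]%B}).

Let blocks_disjoint w r : subseq (w :: r) s ->
  [disjoint L w & (\bigcup_(v <- r) L v)%SET]%B.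
Proof.
move=> wr; have /andP[wNr _] := subseq_uniq wr us.
have ws : w \in s by apply: (mem_subseq wr); rewrite mem_head.
have rs : {subset r <= s} by move=> v vr; apply: (mem_subseq wr); rewrite inE vr orbT.
rewrite -setI_eq0 big_distrr /= big1_seq // => v /= vr; apply/eqP.
rewrite setI_eq0; apply: Ldisj => //; first exact: rs.
by apply: contraNneq wNr => ->.
Qed.

Lemma generated_blocks_indep (E : W -> set Omega) :
  (forall w, w \in s -> generated (L w) (E w)) ->
  P (\big[setI/setT]_(w <- s) E w) = \prod_(w <- s) P (E w).
Proof.
move=> gE.
(* The induction also records that the intersection is generated by the union of its blocks, a union
   disjoint from the next block. *)
suff H r : subseq r s ->
    P (\big[setI/setT]_(w <- r) E w) = \prod_(w <- r) P (E w) /\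
    generated (\bigcup_(v <- r) L v)%SET (\big[setI/setT]_(w <- r) E w).
  by have [] := H s (subseq_refl s).
elim: r => [|w r IH] wr.
  by rewrite !big_nil probability_setT; split => //; exact: generatedT.
have [IH1 IH2] := IH (subseq_trans (subseq_cons r w) wr).
have ws : w \in s by apply: (mem_subseq wr); rewrite mem_head.
rewrite !big_cons -IH1; split.
  by apply: (generated_indep (blocks_disjoint wr)) => //; exact: gE.
apply: generatedI.
  by apply: (generated_sub _ (gE w ws)); exact: finset.subsetUl.
by apply: (generated_sub _ IH2); exact: finset.subsetUr.
Qed.

Lemma adapted_blocks_expectation (f : W -> Omega -> R) :
  (forall w, w \in s -> adapted (L w) (f w)) -> (forall w x, (0 <= f w x)%R) ->
  \int[P]_x (\prod_(w <- s) f w x)%:E = \prod_(w <- s) \int[P]_x (f w x)%:E.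
Proof.
move=> fL f0.
suff H r : subseq r s ->
    \int[P]_x (\prod_(w <- r) f w x)%:E = \prod_(w <- r) \int[P]_x (f w x)%:E /\
    adapted (\bigcup_(v <- r) L v)%SET (fun x => \prod_(w <- r) f w x)%R.
  by have [] := H s (subseq_refl s).
elim: r => [|w r IH] wr.
  rewrite !big_nil; split.
    under eq_integral do rewrite big_nil.
    exact: integral_probability_cst.
  rewrite /adapted (_ : (fun x => _) = cst 1%R); first exact: measurable_cst.
  by apply/funext => x; rewrite big_nil.
have [IH1 IH2] := IH (subseq_trans (subseq_cons r w) wr).
have ws : w \in s by apply: (mem_subseq wr); rewrite mem_head.
pose g x := (\prod_(v <- r) f v x)%R.
have gL : adapted (\bigcup_(v <- r) L v)%SET g := IH2.
split.
  have fg : independent2 P (f w) g.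
    exact: (adapted_independent2 (blocks_disjoint wr) (fL w ws) gL).
  rewrite big_cons -IH1 -(independent2_integralM _ _ fg); last 4 first.
  - exact: adapted_measurable (fL w ws).
  - exact: adapted_measurable gL.
  - by move=> x; exact: f0.
  - by move=> x; exact: prodr_ge0.
  by apply: eq_integral => x _; rewrite big_cons.
rewrite /adapted (_ : (fun x => _) = (fun x => f w x * g x)%R); last first.
  by apply/funext => x; rewrite big_cons.
rewrite big_cons; apply: measurable_funM.
  by apply: (adapted_sub _ (fL w ws)); exact: finset.subsetUl.
by apply: (adapted_sub _ IH2); exact: finset.subsetUr.
Qed.

End blocks.

End generated_sigma_algebra.

(** * Event trees *)

Section event_tree_theory.
Context (V : finType) (e : rel V) (v0 : V).
Hypothesis tree : event_tree e v0.

Lemma walk_exists v : exists2 p, path e v0 p & last v0 p = v.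
Proof. by have [p [[ep lp] _]] := tree v; exists p. Qed.

Lemma walk_unique p q :
  path e v0 p -> path e v0 q -> last v0 p = last v0 q -> p = q.
Proof.
move=> ep eq pq; have [r [_ ur]] := tree (last v0 p).
by rewrite -(ur p) // -(ur q).
Qed.

Definition paths_through (v : V) : {set rtl_path e v0} :=
  [set l : rtl_path e v0 | v \in (val l : seq V)].

Lemma mem_paths_through v l : (l \in paths_through v) = (v \in (val l : seq V)).
Proof. by rewrite inE. Qed.

(** Cutting [l] at [v] leaves a walk from the root to [v], and there is only one. *)
Lemma paths_throughP v q (l : rtl_path e v0) :
  path e v0 q -> last v0 q = v -> l \in paths_through v ->
  exists r, [/\ (val l : seq V) = v0 :: q ++ r, path e v r &
    last v r \notin situations e].
Proof.
move=> eq lq; rewrite inE; have := valP l; move: (val l : seq V) => [|x p] //=.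
case/and3P => /eqP -> ep lp vp.
case/splitPl: vp ep lp => p1 p2 lp1; rewrite cat_path last_cat => /andP[ep1 ep2] lp2.
have <- : p1 = q by apply: walk_unique => //; rewrite lp1.
by exists p2; rewrite -lp1.
Qed.

Lemma paths_through_child v w : e v w -> paths_through w \subset paths_through v.
Proof.
move=> vw; apply/fintype.subsetP => l lw; have [q eq lq] := walk_exists v.
have eqw : path e v0 (rcons q w) by rewrite rcons_path eq lq.
have [r [lE _ _]] := paths_throughP eqw (last_rcons _ _ _) lw.
by rewrite mem_paths_through lE -cat_cons -rcons_cons mem_cat mem_rcons
  in_cons -lq mem_last orbT.
Qed.

(** A path can enter [w] only from its parent [v]. Edge rates thus become node rates of children. *)
Lemma infix_child v w (l : rtl_path e v0) : e v w ->
  infix [:: v; w] (val l : seq V) = (l \in paths_through w).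
Proof.
move=> vw; apply/idP/idP => [|lw].
  by move=> /mem_infix h; rewrite inE h // !inE eqxx orbT.
have [q eq lq] := walk_exists v.
have eqw : path e v0 (rcons q w) by rewrite rcons_path eq lq.
have [r [lE _ _]] := paths_throughP eqw (last_rcons _ _ _) lw.
rewrite lE; apply/infixP; exists (belast v0 q), r.
by rewrite -cat_cons -rcons_cons lastI lq -!cats1 -!catA.
Qed.

Lemma paths_through_situation v (l : rtl_path e v0) : v \in situations e ->
  l \in paths_through v -> exists2 w, e v w & l \in paths_through w.
Proof.
move=> vS lv; have [q eq lq] := walk_exists v.
have [[|w r] [lE er lr]] := paths_throughP eq lq lv.
  by rewrite /= vS in lr.
move: er => /= /andP[vw _]; exists w => //.
by rewrite inE lE inE mem_cat inE eqxx !orbT.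
Qed.

(** The walks to [w] and [w'] are prefixes of [l] of the same length. *)
Lemma child_unique v w w' (l : rtl_path e v0) : e v w -> e v w' ->
  l \in paths_through w -> l \in paths_through w' -> w = w'.
Proof.
move=> vw vw' lw lw'; have [q eq lq] := walk_exists v.
have ew : path e v0 (rcons q w) by rewrite rcons_path eq lq.
have ew' : path e v0 (rcons q w') by rewrite rcons_path eq lq.
have [r [lE _ _]] := paths_throughP ew (last_rcons _ _ _) lw.
have [r' [lE' _ _]] := paths_throughP ew' (last_rcons _ _ _) lw'.
move: lE'; rewrite lE => -[] /eqP; rewrite eqseq_cat ?size_rcons //.
by case/andP => /eqP/rcons_inj[].
Qed.

Lemma paths_through_children_disjoint v w w' : e v w -> e v w' -> w != w' ->
  [disjoint paths_through w & paths_through w']%B.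
Proof.
move=> vw vw' ww'; apply/pred0P => l /=; apply/negP => /andP[lw lw'].
by rewrite (child_unique vw vw' lw lw') eqxx in ww'.
Qed.

Lemma paths_through_connect v u :
  connect e v u -> paths_through u \subset paths_through v.
Proof.
case/connectP => p; elim: p v => [|w p IH] v /=; first by move=> _ ->.
case/andP => vw ep up.
exact: fintype.subset_trans (IH _ ep up) (paths_through_child vw).
Qed.

Lemma connect_child v u : connect e v u ->
  u = v \/ exists2 w, e v w & connect e w u.
Proof.
case/connectP => -[|w p] /= ; first by move=> _ ->; left.
by case/andP => vw ep up; right; exists w => //; apply/connectP; exists p.
Qed.

Lemma child_not_connect v w : e v w -> ~~ connect e w v.
Proof.
move=> vw; apply/negP => /connectP[p ep vp]; have [q eq lq] := walk_exists v.
(* A walk back from [w] to [v] would extend [q] to a second walk to [v]. *)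
have /(congr1 size)/eqP : q = q ++ w :: p.
  apply: walk_unique => //; rewrite ?cat_path ?last_cat ?eq lq //=.
  by rewrite vw.
by rewrite size_cat /= -[X in X == _]addn0 eqn_add2l.
Qed.

(** Contains [v] itself. Its cardinality is the measure of the inductions from the leaves
    upwards. *)
Definition below (v : V) : {set V} := [set u | connect e v u].

Lemma below_child_card v w : e v w -> (#|below w| < #|below v|)%N.
Proof.
move=> vw; apply/proper_card/properP; split.
  apply/fintype.subsetP => u; rewrite !inE; apply: connect_trans.
  exact: connect1.
by exists v; rewrite !inE ?connect0 ?child_not_connect.
Qed.

Lemma paths_through_nonempty v : exists l, l \in paths_through v.
Proof.
have [r er lr] : exists2 r, path e v r & last v r \notin situations e.
  have [n] := ubnP #|below v|; elim: n v => // n IH v vn.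
  have [vS|vS] := boolP (v \in situations e); last by exists [::].
  have [w] : exists w, w \in children e v.
    by apply/card_gt0P; move: vS; rewrite inE.
  rewrite inE => vw; have [r er lr] := IH w (leq_trans (below_child_card vw) vn).
  by exists (w :: r) => //=; rewrite vw.
have [q eq lq] := walk_exists v.
have rl : root_to_leaf e v0 (v0 :: q ++ r).
  by rewrite /= eqxx cat_path eq last_cat lq er lr.
have sz := size_root_to_leaf tree rl.
exists (exist _ (Bseq sz) rl : rtl_path e v0).
by rewrite mem_paths_through /= -cat_cons mem_cat -{1}lq mem_last.
Qed.

Section tree_rates.
Context (R : realType) (Omega : Type) (gamma : rtl_path e v0 -> Omega -> R).

Lemma edge_rateE v w x : e v w -> edge_rate gamma v w x = node_rate gamma w x.
Proof. by move=> vw; apply: eq_bigl => l; rewrite infix_child // inE. Qed.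

(** After exchanging the sums, every path through [v] is counted once, as it passes through exactly
    one child. *)
Lemma node_rate_children v x : v \in situations e ->
  node_rate gamma v x = \sum_(w in children e v) node_rate gamma w x.
Proof.
move=> vS; rewrite /node_rate.
rewrite (exchange_big_dep (fun l : rtl_path e v0 => v \in (val l : seq V))) /=; last first.
  move=> w l; rewrite inE => vw lw.
  by have /fintype.subsetP/(_ l) := paths_through_child vw; rewrite !inE => ->.
apply: eq_bigr => l lv.
have lv' : l \in paths_through v by rewrite inE.
have [w vw lw] := paths_through_situation vS lv'.
rewrite (big_pred1 w) // => u; rewrite inE /=; apply/andP/eqP => [[vu lu]|->].
  by apply: (child_unique (l := l) vu vw) => //; rewrite mem_paths_through.
by rewrite inE in lw.
Qed.

Lemma node_rate_sum_child v x : v \in situations e ->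
  node_rate gamma v x = \sum_(i < outdeg e v) node_rate gamma (child i) x.
Proof.
move=> vS; rewrite node_rate_children // /child.
by rewrite (big_enum_val (fun w => node_rate gamma w x)).
Qed.

Lemma child_edge v (i : 'I_(outdeg e v)) : e v (child i).
Proof. by have := enum_valP i; rewrite inE. Qed.

Lemma floret_probsE v x : floret_probs gamma v x =
  [tuple node_rate gamma (child i) x / node_rate gamma v x | i < outdeg e v].
Proof. by apply: eq_mktuple => i; rewrite edge_rateE //; exact: child_edge. Qed.

Lemma node_rate_gt0 v x : (forall l, 0 < gamma l x) -> 0 < node_rate gamma v x.
Proof.
move=> g0; have [l lv] := paths_through_nonempty v.
rewrite /node_rate (bigD1 l) /=; last by rewrite inE in lv.
by rewrite ltr_wpDr // sumr_ge0 // => i _; exact: ltW.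
Qed.

End tree_rates.

End event_tree_theory.

(** * Lukacs' theorem *)

Section dirichlet_moment_characterization.
Context (R : realType).

(** The Pochhammer symbol. *)
Definition rising (a : R) (n : nat) : R := \prod_(j < n) (a + j%:R).

Lemma gamma_fun_rising (a : R) n : 0 < a ->
  gamma_fun (a + n%:R) = rising a n * gamma_fun a.
Proof.
move=> a0; elim: n => [|n IH]; first by rewrite addr0 /rising big_ord0 mul1r.
rewrite -natr1 addrA gamma_funD1; last by rewrite ltr_wpDr.
by rewrite IH /rising big_ord_recr /= mulrA [_ * (a + _)]mulrC.
Qed.

Definition incr (k : nat) (e : 'I_k -> nat) (i : 'I_k) : 'I_k -> nat :=
  fun j => (e j + (j == i))%N.

Lemma sum_incr k (e : 'I_k -> nat) i : (\sum_j incr e i j = (\sum_j e j).+1)%N.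
Proof.
rewrite big_split /= -addn1; congr addn.
by rewrite (bigD1 i) //= eqxx big1 // => j /negbTE ->.
Qed.

Section characterization.
Variables (k : nat) (a : 'I_k -> nat -> R) (c : ('I_k -> nat) -> R) (s : nat -> R).
Hypotheses (a0 : forall i n, 0 < a i n) (c0 : forall e, 0 < c e)
  (s0 : forall n, 0 < s n) (c1 : c (fun=> 0%N) = 1).
Hypothesis prod_a : forall e, \prod_i a i (e i) = c e * s (\sum_i e i)%N.
Hypothesis sum_c : forall e, c e = \sum_i c (incr e i).

Let rho i n := a i n.+1 / a i n.

Let rho_gt0 i n : 0 < rho i n. Proof. by rewrite divr_gt0. Qed.

Let prod_incr e i : \prod_j a j (incr e i j) = \prod_j a j (e j) * rho i (e i).
Proof.
rewrite (bigD1 i) //= [in RHS](bigD1 i) //= /incr eqxx addn1 /rho.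
rewrite mulrAC [a i (e i) * _]mulrC divfK ?gt_eqF //; congr (_ * _).
by apply: eq_bigr => j /negbTE ->; rewrite addn0.
Qed.

(** By [prod_a], each [rho i (e i)] is [c (incr e i) / c e] times the right side, and by [sum_c]
    these quotients add up to 1. *)
Lemma sum_rho e : \sum_i rho i (e i) = s (\sum_i e i).+1 / s (\sum_i e i)%N.
Proof.
have sn0 n : s n != 0 by rewrite gt_eqF.
have cn0 : c e != 0 by rewrite gt_eqF.
apply: (mulfI cn0); apply: (mulIf (sn0 (\sum_i e i)%N)).
rewrite mulrA divfK // {2}sum_c mulr_suml mulrAC -prod_a mulr_sumr.
by apply: eq_bigr => i _; rewrite -prod_incr prod_a sum_incr.
Qed.

(** Raising the exponent at [i] or at [j] gives the same total, hence the same sum of ratios, and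
    all other terms cancel. *)
Let rho_exchange i j n m : i != j ->
  rho i n.+1 + rho j m = rho i n + rho j m.+1.
Proof.
move=> ij; pose e l : nat := if l == i then n else if l == j then m else 0%N.
have ei : e i = n by rewrite /e eqxx.
have ej : e j = m by rewrite /e eq_sym (negbTE ij) eqxx.
have := sum_rho (incr e i); rewrite sum_incr -(sum_incr e j) -sum_rho.
rewrite (bigD1 i) //= (bigD1 j) 1?eq_sym //= [in RHS](bigD1 i) //=.
rewrite [in RHS](bigD1 j) 1?eq_sym //= /incr !eqxx (negbTE ij) [j == i]eq_sym (negbTE ij).
rewrite !addn0 !addn1 ei ej !addrA.
rewrite (eq_bigr (fun l => rho l (e l + (l == j))%N)); first exact: addIr.
by move=> l /andP[/negbTE -> /negbTE ->].
Qed.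

Hypothesis k1 : (1 < k)%N.
Variable i0 : 'I_k.
Hypothesis a_i0 : a i0 1 ^+ 2 < a i0 0 * a i0 2.

Let theta := rho i0 1 - rho i0 0.

Let theta_gt0 : 0 < theta.
Proof.
rewrite subr_gt0 /rho ltr_pdivrMr // mulrAC ltr_pdivlMr //.
by rewrite [ltRHS]mulrC -expr2.
Qed.

Let rhoS i n : rho i n.+1 = rho i n + theta.
Proof.
have [->|ii0] := eqVneq i i0; last first.
  have := rho_exchange n 0 ii0; rewrite /theta => h.
  by rewrite addrA -h addrK.
(* For [i0] itself the exchange needs a partner [j]: every increment of [rho i0] equals the first
   increment of [rho j]. *)
have [j ji0] : exists j : 'I_k, j != i0.
  have /card_gt0P[j] : (0 < #|[set~ i0]%SET|)%N.
    by rewrite cardsC1 card_ord; case: k k1 => [|[]].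
  by rewrite !inE => ji0; exists j.
have h1 := rho_exchange 0 n ji0; have h2 := rho_exchange 0 0 ji0.
rewrite /theta addrA; apply: (addrI (rho j 0)).
move: h1 h2; lra.
Qed.

Let alpha i := rho i 0 / theta.

Let rhoE i n : rho i n = theta * (alpha i + n%:R).
Proof.
elim: n => [|n IH]; first by rewrite addr0 mulrC divfK // gt_eqF.
by rewrite rhoS IH -natr1; ring.
Qed.

Let aE i n : a i n = a i 0 * theta ^+ n * rising (alpha i) n.
Proof.
elim: n => [|n IH]; first by rewrite expr0 /rising big_ord0 !mulr1.
have -> : a i n.+1 = rho i n * a i n by rewrite divfK // gt_eqF.
by rewrite rhoE IH /rising big_ord_recr /= exprS; ring.
Qed.

Let sE n : s n = s 0 * theta ^+ n * rising (\sum_i alpha i) n.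
Proof.
elim: n => [|n IH]; first by rewrite expr0 /rising big_ord0 !mulr1.
(* One exponent vector of total [n] is enough to read the ratio [s n.+1 / s n] off [sum_rho]. *)
pose e j : nat := if j == i0 then n else 0%N.
have en : (\sum_j e j = n)%N.
  by rewrite (bigD1 i0) //= /e eqxx big1 ?addn0 // => j /negbTE ->.
have := sum_rho e; rewrite en => /esym h.
have -> : s n.+1 = s n.+1 / s n * s n by rewrite divfK // gt_eqF.
rewrite h; under eq_bigr do rewrite rhoE.
rewrite -mulr_sumr big_split /= -natr_sum en IH /rising big_ord_recr /= exprS; ring.
Qed.

Lemma dirichlet_moment_characterization :
  exists2 al : 'I_k -> R, (forall i, 0 < al i) &
  forall e, c e = \prod_i rising (al i) (e i) / rising (\sum_i al i) (\sum_i e i)%N.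
Proof.
exists alpha; first by move=> i; rewrite divr_gt0.
move=> e; have sn0 n : s n != 0 by rewrite gt_eqF.
(* Exponent zero matches the constants; the powers of [theta] cancel because both sides have the
   same total degree. *)
have s00 : \prod_i a i 0 = s 0.
  by rewrite (prod_a (fun=> 0%N)) c1 mul1r big1.
have th n : theta ^+ n != 0 by rewrite expf_neq0 // gt_eqF.
have := sn0 (\sum_i e i)%N; rewrite sE => /[dup] sN0.
rewrite mulf_eq0 negb_or => /andP[_ r0].
apply: (mulIf (sn0 (\sum_i e i)%N)); rewrite -prod_a.
under eq_bigr do rewrite aE.
rewrite 2!big_split /= s00 (sE (\sum_i e i)%N) prodrXr.
by field.
Qed.

End characterization.

End dirichlet_moment_characterization.

Section lukacs.
Context (d : measure_display) (Omega : measurableType d) (R : realType)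
  (P : probability Omega R).
Local Open Scope ereal_scope.

(** The term [x ^ n / n!] of the exponential series gives the bound. *)
Lemma exprn_expRN_bound (n : nat) (x : R) : (0 <= x)%R ->
  (0 <= x ^+ n * expR (- x) <= n`!%:R)%R.
Proof.
move=> x0; rewrite mulr_ge0 ?exprn_ge0 ?expR_ge0 //= expRN ler_pdivrMr ?expR_gt0 //.
case: n => [|n].
  by rewrite expr0 mul1r -expR0 ler_expR.
rewrite mulrC -ler_pdivrMr ?ltr0n ?fact_gt0 //.
apply: le_trans (expR_ge1Dxn n x0); by rewrite lerDr.
Qed.

Lemma bounded_expectation_fin_num (f : Omega -> R) (M : R) : measurable_fun setT f ->
  (forall x, (0 <= f x <= M)%R) -> \int[P]_x (f x)%:E \is a fin_num.
Proof.
move=> mf fM; rewrite ge0_fin_numE; last first.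
  by apply: integral_ge0 => x _; rewrite lee_fin; have /andP[] := fM x.
apply: (@le_lt_trans _ _ (\int[P]_x M%:E)).
  apply: ge0_le_integral => //.
  - by move=> x _; rewrite lee_fin; have /andP[] := fM x.
  - exact/measurable_EFinP.
  - by move=> x _; rewrite lee_fin; have /andP[] := fM x.
by rewrite integral_probability_cst ltry.
Qed.

Variables (k : nat) (X : 'I_k -> Omega -> R).
Hypotheses (k1 : (1 < k)%N) (mX : forall i, measurable_fun setT (X i))
  (X0 : forall i x, (0 < X i x)%R).
Hypothesis indepX : mutually_independent P [set: 'I_k]%SET X.

Let S (x : Omega) : R := (\sum_i X i x)%R.
Let Q (x : Omega) : k.-tuple R := [tuple X i x / S x | i < k]%R.

Let S0 x : (0 < S x)%R.
Proof.
rewrite /S (bigD1 (Ordinal (ltnW k1))) //= ltr_wpDr // sumr_ge0 // => i _.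
exact: ltW.
Qed.

Let mS : measurable_fun setT S. Proof. exact: measurable_sum. Qed.

Let mQi i : measurable_fun setT (fun x => tnth (Q x) i).
Proof.
rewrite (_ : (fun x => _) = (fun x => X i x * S x `^ (-1))%R); last first.
  by apply/funext => x; rewrite tnth_mktuple powR_inv1 // ltW.
apply: measurable_funM => //.
exact: (measurableT_comp (f := fun y : R => (y `^ (-1))%R) (measurable_powR (-1)) mS).
Qed.

Let mQ : measurable_fun setT Q.
Proof. by apply/measurable_fun_tnthP => i; exact: mQi. Qed.

Let sumQ x : (\sum_i tnth (Q x) i = 1)%R.
Proof.
under eq_bigr do rewrite tnth_mktuple.
by rewrite -mulr_suml -/(S x) mulfV // gt_eqF.
Qed.

Let Q_gt0 x i : (0 < tnth (Q x) i)%R.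
Proof. by rewrite tnth_mktuple divr_gt0. Qed.

Let Q_le1 x i : (tnth (Q x) i <= 1)%R.
Proof.
rewrite -(sumQ x) (bigD1 i) //= lerDl sumr_ge0 // => j _; exact/ltW/Q_gt0.
Qed.

Hypothesis indepQS : independent2 P Q S.

Let wexp (n : nat) (x : R) : R := (x ^+ n * expR (- x))%R.

Let mwexp n : measurable_fun setT (wexp n).
Proof. by apply: measurable_funM; [exact: measurable_funX|exact: measurable_expRN]. Qed.

Let wmoment (Y : Omega -> R) n : R := fine (\int[P]_x (wexp n (Y x))%:E).

Let wmomentE (Y : Omega -> R) n : measurable_fun setT Y -> (forall x, (0 < Y x)%R) ->
  \int[P]_x (wexp n (Y x))%:E = (wmoment Y n)%:E.
Proof.
move=> mY Y0; rewrite fineK //.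
apply: (@bounded_expectation_fin_num _ n`!%:R).
  exact: (measurableT_comp (mwexp n) mY).
by move=> x; apply: exprn_expRN_bound; exact: ltW.
Qed.

Let wmoment_gt0 (Y : Omega -> R) n : measurable_fun setT Y -> (forall x, (0 < Y x)%R) ->
  (0 < wmoment Y n)%R.
Proof.
move=> mY Y0; rewrite -lte_fin -wmomentE //.
have w0 x : (0 < wexp n (Y x))%R by rewrite mulr_gt0 ?exprn_gt0 ?expR_gt0.
apply: ge0_expectation_gt0; first exact: (measurableT_comp (mwexp n) mY).
  by move=> x; exact: ltW.
rewrite (_ : _ @^-1` _ = set0) ?measure0 //.
by apply/seteqP; split => // x /= h; have := w0 x; rewrite h ltxx.
Qed.

Let qprod (e : 'I_k -> nat) (x : Omega) : R := (\prod_i tnth (Q x) i ^+ e i)%R.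

Let qprod_itv e x : (0 < qprod e x <= 1)%R.
Proof.
rewrite prodr_gt0 /=; last by move=> i _; rewrite exprn_gt0.
apply: prodr_ile1 => i _; rewrite exprn_ge0 ?exprn_ile1 //; exact/ltW/Q_gt0.
Qed.

Let mqprod e : measurable_fun setT (qprod e).
Proof. by apply: measurable_prod => i _; apply: measurable_funX; exact: mQi. Qed.

Let qmoment e : R := fine (\int[P]_x (qprod e x)%:E).

Let qmomentE e : \int[P]_x (qprod e x)%:E = (qmoment e)%:E.
Proof.
rewrite fineK //; apply: (@bounded_expectation_fin_num _ 1%R); first exact: mqprod.
move=> x.
by have /andP[/ltW -> ->] := qprod_itv e x.
Qed.

Let qmoment_gt0 e : (0 < qmoment e)%R.
Proof.
rewrite -lte_fin -qmomentE; apply: ge0_expectation_gt0; first exact: mqprod.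
  by move=> x; have /andP[/ltW] := qprod_itv e x.
rewrite (_ : _ @^-1` _ = set0) ?measure0 //.
apply/seteqP; split => // x /= h.
by have := qprod_itv e x; rewrite h ltxx.
Qed.

Let prod_wmoment e :
  (\prod_i wmoment (X i) (e i) = qmoment e * wmoment S (\sum_i e i)%N)%R.
Proof.
apply: EFin_inj; rewrite EFinM -qmomentE -wmomentE //.
rewrite -independent2_integralM //; last 4 first.
- exact: (measurableT_comp (mwexp _) mS).
- move=> A B mA mB.
  have mA' : measurable [set t : k.-tuple R | A (\prod_i tnth t i ^+ e i)%R].
    have h : measurable_fun [set: k.-tuple R] (fun t => \prod_i tnth t i ^+ e i)%R.
      by apply: measurable_prod => i _; apply: measurable_funX; exact: measurable_tnth.
    by have := h measurableT A mA; rewrite setTI.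
  have mB' : measurable [set y : R | B (wexp (\sum_i e i)%N y)].
    by have := mwexp (\sum_i e i)%N measurableT mB; rewrite setTI.
  exact: (indepQS mA' mB').
- by move=> x; have /andP[/ltW] := qprod_itv e x.
- by move=> x; rewrite mulr_ge0 ?expR_ge0 // exprn_ge0 // ltW.
rewrite -prodEFin (eq_bigr (fun i => \int[P]_x (wexp (e i) (X i x))%:E)); last first.
  by move=> i _; rewrite wmomentE.
have := @adapted_blocks_expectation _ Omega R P 'I_k X mX indepX 'I_k
  (fun i => [set i]%SET) (index_enum 'I_k) (index_enum_uniq _) _
  (fun i x => wexp (e i) (X i x)).
move=> <-; last 3 first.
- move=> i j _ _ ij; apply/pred0P => l /=; rewrite !inE.
  by apply/negP => /andP[/eqP -> /eqP h]; rewrite h eqxx in ij.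
- move=> i _; apply: (measurableT_comp (mwexp (e i))).
  by apply: adapted_coordinate; rewrite inE.
- by move=> i x; rewrite mulr_ge0 ?expR_ge0 // exprn_ge0 // ltW.
apply: eq_integral => x _; congr EFin.
(* As [X i] is [S] times coordinate [i] of [Q], the powers regroup into [qprod e] and a power of
   [S]; the exponentials multiply to [expR (- S x)]. *)
rewrite /qprod /wexp big_split /= mulrA; congr (_ * _)%R; last first.
  by rewrite -expR_sum -sumrN.
rewrite -prodrXr -big_split /=; apply: eq_bigr => i _.
by rewrite -exprMn tnth_mktuple divfK // gt_eqF.
Qed.

(** Insert the factor 1 as the sum of the coordinates of [Q]. *)
Let sum_qmoment e : (qmoment e = \sum_i qmoment (incr e i))%R.
Proof.
apply: EFin_inj; rewrite -sumEFin -qmomentE.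
under [RHS]eq_bigr do rewrite -qmomentE.
rewrite -ge0_integral_sum //; last 2 first.
- by move=> i; apply/measurable_EFinP; exact: mqprod.
- by move=> i x _; rewrite lee_fin; have /andP[/ltW] := qprod_itv (incr e i) x.
apply: eq_integral => x _; rewrite sumEFin; congr EFin.
rewrite -[LHS]mulr1 -(sumQ x) mulr_sumr; apply: eq_bigr => i _.
rewrite /qprod (bigD1 i) //= [RHS](bigD1 i) //= /incr eqxx addn1 exprSr.
rewrite mulrAC; congr (_ * _)%R.
by apply: eq_bigr => j /negbTE ->; rewrite addn0.
Qed.

Variable i0 : 'I_k.
Hypothesis atomless : forall c, P (X i0 @^-1` [set c]) = 0.

(** Cauchy-Schwarz for the weight [expR (- Y)]. It is strict because [Y] has no atom; with it the
    common difference [theta] is positive. *)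
Let wmoment_strict :
  (wmoment (X i0) 1 ^+ 2 < wmoment (X i0) 0 * wmoment (X i0) 2)%R.
Proof.
set Y := X i0; have mY : measurable_fun setT Y by exact: mX.
have Y0 x : (0 < Y x)%R by exact: X0.
have A0 := wmoment_gt0 0 mY Y0; have A1 := wmoment_gt0 1 mY Y0.
(* The weighted mean of [Y]; the integral of [V] is its unnormalized weighted variance. *)
pose r := (wmoment Y 1 / wmoment Y 0)%R.
have r0 : (0 < r)%R by rewrite divr_gt0.
pose V x := ((Y x - r) ^+ 2 * expR (- Y x))%R.
have mV : measurable_fun setT V.
  apply: measurable_funM; first by apply: measurable_funX; exact: measurable_funB.
  exact: (measurableT_comp (@measurable_expRN R) mY).
have V0 x : (0 <= V x)%R by rewrite mulr_ge0 ?expR_ge0 ?sqr_ge0.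
have : 0 < \int[P]_x (V x)%:E.
  apply: ge0_expectation_gt0 => //; rewrite -(atomless r); congr (P _).
  apply/seteqP; split => x /=.
    by move/eqP; rewrite mulf_eq0 (gt_eqF (expR_gt0 _)) orbF sqrf_eq0 subr_eq0 => /eqP.
  by rewrite /V /Y => ->; rewrite subrr expr0n mul0r.
have mw n : measurable_fun setT (fun x => (wexp n (Y x))%:E).
  by apply/measurable_EFinP; exact: (measurableT_comp (mwexp n) mY).
have w0 n x : 0 <= (wexp n (Y x))%:E.
  by rewrite lee_fin mulr_ge0 ?expR_ge0 // exprn_ge0 // ltW.
(* The expanded square is arranged with nonnegative terms on both sides, so that additivity of
   nonnegative integrals applies. *)
have : \int[P]_x ((V x)%:E + (2 * r)%:E * (wexp 1 (Y x))%:E) =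
    \int[P]_x ((wexp 2 (Y x))%:E + (r ^+ 2)%:E * (wexp 0 (Y x))%:E).
  apply: eq_integral => x _; rewrite -!EFinM -!EFinD; congr EFin.
  by rewrite /V /wexp; ring.
have r2 : (0 <= 2 * r)%R by rewrite mulr_ge0 // ltW.
rewrite !ge0_integralD //; last 6 first.
- by move=> x _; rewrite mule_ge0 // lee_fin sqr_ge0.
- exact: measurable_funeM.
- by move=> x _; rewrite lee_fin.
- exact/measurable_EFinP.
- by move=> x _; rewrite mule_ge0.
- exact: measurable_funeM.
rewrite !ge0_integralZl ?lee_fin ?sqr_ge0 //.
rewrite !wmomentE //.
have Vfin : \int[P]_x (V x)%:E \is a fin_num.
  (* The bound is [2!] for the quadratic term plus [r ^+ 2] for the constant one; the middle term is
     at most 0. *)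
  apply: (@bounded_expectation_fin_num _ (2 + r ^+ 2)%R) => // x; rewrite V0 /=.
  have -> : V x = (wexp 2 (Y x) - 2 * (r * wexp 1 (Y x)) + r ^+ 2 * wexp 0 (Y x))%R.
    by rewrite /V /wexp; ring.
  have /andP[_ h2] := exprn_expRN_bound 2 (ltW (Y0 x)).
  have /andP[h1 _] := exprn_expRN_bound 1 (ltW (Y0 x)).
  have /andP[_ h0] := exprn_expRN_bound 0 (ltW (Y0 x)).
  have h1r : (0 <= r * wexp 1 (Y x))%R by rewrite mulr_ge0 // ltW.
  have h0r : (r ^+ 2 * wexp 0 (Y x) <= r ^+ 2)%R by rewrite ler_piMr // sqr_ge0.
  have {}h2 : (wexp 2 (Y x) <= 2)%R by exact: h2.
  by lra.
rewrite -(fineK Vfin); set v := fine _.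
rewrite -!EFinM -!EFinD lte_fin => -[h] v0.
have hr : (wmoment Y 1 = r * wmoment Y 0)%R by rewrite divfK // gt_eqF.
have A2E : (wmoment Y 2 = v + 2 * r * wmoment Y 1 - r ^+ 2 * wmoment Y 0)%R.
  by move: h; lra.
have : (0 < v * wmoment Y 0)%R by rewrite mulr_gt0.
rewrite A2E hr; set A := wmoment Y 0; lra.
Qed.

Lemma lukacs_moments : exists2 al : 'I_k -> R, (forall i, (0 < al i)%R) &
  forall e, \int[P]_x (\prod_i tnth (Q x) i ^+ e i)%:E =
    (\prod_i rising (al i) (e i) / rising (\sum_i al i) (\sum_i e i)%N)%:E.
Proof.
have q1 : qmoment (fun=> 0%N) = 1%R.
  rewrite /qmoment; under eq_integral.
    by move=> x _; rewrite /qprod big1 //; over.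
  by rewrite integral_probability_cst.
have [al al0 H] := dirichlet_moment_characterization
  (fun i n => wmoment_gt0 n (mX i) (X0 i)) qmoment_gt0
  (fun n => wmoment_gt0 n mS S0) q1 prod_wmoment sum_qmoment k1 wmoment_strict.
by exists al => // e; rewrite -H -qmomentE.
Qed.

End lukacs.

Section lukacs_dirichlet.
Context (d : measure_display) (Omega : measurableType d) (R : realType)
  (P : probability Omega R).

Lemma sum_simplex_point n (t : n.-tuple R) :
  \sum_i tnth (simplex_point (k := n.+1) t) i = 1.
Proof.
rewrite big_ord_recr /= simplex_point_max.
by under eq_bigr do rewrite simplex_point_widen; rewrite addrC subrK.
Qed.

(** Both laws are put in the form [weighted_law], one over [P] and one over the measure behind
    [iter_integral], and their moments are compared. *)
Lemma has_dirichlet_of_moments n (Q : Omega -> n.+1.-tuple R) (alpha : 'I_n.+1 -> R) :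
  measurable_fun setT Q -> (forall x i, 0 <= tnth (Q x) i <= 1) ->
  (forall i, 0 < alpha i) ->
  (forall e : 'I_n.+1 -> nat, (\int[P]_x (\prod_i tnth (Q x) i ^+ e i)%:E)%E =
    (\prod_i rising (alpha i) (e i) / rising (\sum_i alpha i) (\sum_i e i)%N)%:E) ->
  has_dirichlet_distribution P Q.
Proof.
move=> mQ Q01 alpha0 momQ; exists alpha => // A mA.
have [m Hm] := iter_integral_measure R n.
pose sp : n.-tuple R -> n.+1.-tuple R := simplex_point (k := n.+1).
have msp : measurable_fun setT sp by exact: measurable_simplex_point.
pose w (t : n.-tuple R) := dirichlet_density alpha (sp t).
have w0 t : 0 <= w t by exact: dirichlet_density_ge0.
have mw : measurable_fun setT w.
  exact: (measurableT_comp (@measurable_dirichlet_density R n alpha) msp).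
have wsp t i : w t != 0 -> 0 <= tnth (sp t) i <= 1.
  rewrite /w /dirichlet_density; case: ifPn; last by rewrite eqxx.
  move=> /forallP sp0 _; rewrite ltW //= -(sum_simplex_point t) (bigD1 i) //=.
  by rewrite lerDl sumr_ge0 // => j _; rewrite ltW // sp0.
have momw e : tuple_moment m w sp e =
    (\prod_i rising (alpha i) (e i) / rising (\sum_i alpha i) (\sum_i e i)%N)%:E.
  rewrite /tuple_moment Hm; last 2 first.
  - apply/measurable_EFinP; apply: measurable_funM => //.
    apply: measurable_prod => i _; apply: measurable_funX.
    by apply: (measurableT_comp (measurable_tnth i)).
  - move=> t; rewrite lee_fin; have [-> |/wsp wt] := eqVneq (w t) 0.
      by rewrite mul0r.
    by rewrite mulr_ge0 // prodr_ge0 // => i _; rewrite exprn_ge0 //; case/andP: (wt i).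
  rewrite dirichlet_moment //; congr EFin.
  have suma0 : 0 < \sum_i alpha i.
    by rewrite (bigD1 ord0) //= ltr_wpDr ?sumr_ge0 // => i _; exact: ltW.
  have -> : \sum_i (alpha i + (e i)%:R) = \sum_i alpha i + (\sum_i e i)%N%:R.
    by rewrite big_split /= natr_sum.
  rewrite gamma_fun_rising // mulfK ?gt_eqF ?gamma_fun_gt0 //.
  congr (_ / _); apply: eq_bigr => i _.
  by rewrite gamma_fun_rising // mulfK // gt_eqF // gamma_fun_gt0.
(* The total mass of the density is its moment with all exponents 0, hence finite. *)
have iw : m.-integrable setT (EFin \o w).
  apply/integrableP; split; first exact/measurable_EFinP.
  have := momw (fun=> 0%N); rewrite /tuple_moment => h.
  rewrite (eq_integral (fun t => (w t * \prod_i tnth (sp t) i ^+ 0)%:E)); last first.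
    move=> t _; rewrite big1 ?mulr1 /= ?ger0_norm // => i _.
  by rewrite h ltry.
have iP : P.-integrable setT (EFin \o cst (1 : R)).
  exact: finite_measure_integrable_cst.
have m1 : measurable_fun [set: Omega] (cst (1 : R)) by exact: measurable_cst.
have H : weighted_law P (cst 1) Q A = weighted_law m w sp A.
  apply: (weighted_law_unique (fun=> ler01) m1 mQ iP (fun t i _ => Q01 t i)
    w0 mw msp iw wsp) => // e.
  by rewrite momw -momQ /tuple_moment; apply: eq_integral => x _; rewrite mul1r.
transitivity (weighted_law P (cst 1) Q A).
  have -> : weighted_law P (cst 1) Q A = (\int[P]_(x in Q @^-1` A) cst 1 x)%E by [].
  rewrite integral_cst ?mul1e //.
  by rewrite -[X in measurable X]setTI; exact: mQ.
rewrite H weighted_lawE // Hm //.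
- apply/measurable_EFinP; apply: measurable_funM => //.
  exact: (measurableT_comp (measurable_indic mA) msp).
- by move=> t; rewrite lee_fin mulr_ge0.
Qed.

Lemma lukacs_dirichlet (k : nat) (X : 'I_k -> Omega -> R) (i0 : 'I_k) : (1 < k)%N ->
  (forall i, measurable_fun setT (X i)) -> (forall i x, 0 < X i x) ->
  mutually_independent P [set: 'I_k]%SET X ->
  independent2 P (fun x => [tuple X i x / \sum_j X j x | i < k]) (fun x => \sum_j X j x) ->
  (forall c, P (X i0 @^-1` [set c]) = 0%E) ->
  has_dirichlet_distribution P (fun x => [tuple X i x / \sum_j X j x | i < k]).
Proof.
case: k X i0 => // n X i0 n1 mX X0 indepX indepQS atomless.
have [alpha alpha0 mom] := lukacs_moments n1 mX X0 indepX indepQS atomless.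
have S0 x : 0 < \sum_j X j x.
  by rewrite (bigD1 i0) //= ltr_wpDr // sumr_ge0 // => i _; exact: ltW.
apply: (has_dirichlet_of_moments (alpha := alpha)) => //.
- apply/measurable_fun_tnthP => i.
  rewrite (_ : _ \o _ = (fun x => X i x * (\sum_j X j x) `^ (-1))); last first.
    by apply/funext => x; rewrite /= tnth_mktuple powR_inv1 // ltW.
  apply: measurable_funM => //.
  apply: (measurableT_comp (f := fun y : R => y `^ (-1)) (measurable_powR (-1))).
  exact: measurable_sum.
- move=> x i; rewrite tnth_mktuple divr_ge0 ?(ltW (X0 _ _)) ?(ltW (S0 _)) //=.
  rewrite ler_pdivrMr // mul1r (bigD1 i) //= lerDl sumr_ge0 // => j _.
  exact: ltW.
Qed.

End lukacs_dirichlet.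

(** * Independence of the florets of a tree *)

Section path_rates.
Context (R : realType) (d : measure_display) (Omega : measurableType d)
  (P : probability Omega R) (V : finType) (e : rel V) (v0 : V)
  (gamma : rtl_path e v0 -> Omega -> R).
Hypotheses (tree : event_tree e v0) (gamma0 : forall l x, 0 < gamma l x)
  (mgamma : forall l, measurable_fun setT (gamma l))
  (indep_gamma : mutually_independent P [set: rtl_path e v0]%SET gamma).

Lemma adapted_sum_rates (L : {set rtl_path e v0}) :
  adapted gamma L (fun x => \sum_(l in L) gamma l x).
Proof.
rewrite /adapted (_ : (fun x => _) = fun x => \sum_l (if l \in L then gamma l x else 0)).
  apply: measurable_sum => l; case: (boolP (l \in L)) => [lL|_]; last exact: measurable_cst.
  exact: adapted_coordinate.
by apply/funext => x; rewrite big_mkcond.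
Qed.

Lemma node_rateE v x :
  node_rate gamma v x = \sum_(l in paths_through e v0 v) gamma l x.
Proof. by apply: eq_bigl => l; rewrite mem_paths_through. Qed.

Lemma adapted_node_rate v :
  adapted gamma (paths_through e v0 v) (node_rate gamma v).
Proof.
rewrite (_ : node_rate gamma v = fun x => \sum_(l in paths_through e v0 v) gamma l x).
  exact: adapted_sum_rates.
by apply/funext => x; exact: node_rateE.
Qed.

Lemma measurable_node_rate v : measurable_fun setT (node_rate gamma v).
Proof.
have h := @adapted_node_rate v; exact: (adapted_measurable mgamma h).
Qed.

(** The domain [T] is left open because the lemma serves for two sigma-algebras on [Omega]: that of
    the path rates through [v] and that of the rates of its children. *)
Lemma measurable_floret_probs d' (T : measurableType d') (N : V -> T -> R) v :
  (forall w, e v w -> measurable_fun setT (N w)) -> measurable_fun setT (N v) ->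
  (forall x, 0 < N v x) ->
  measurable_fun setT (fun x => [tuple N (child i) x / N v x | i < outdeg e v]).
Proof.
move=> mNw mNv Nv0; apply/measurable_fun_tnthP => i.
rewrite (_ : _ \o _ = (fun x => N (child i) x * N v x `^ (-1))); last first.
  by apply/funext => x; rewrite /= tnth_mktuple powR_inv1 // ltW.
apply: measurable_funM; first exact/mNw/child_edge.
exact: (measurableT_comp (f := fun y : R => y `^ (-1)) (measurable_powR (-1)) mNv).
Qed.

Lemma adapted_floret_probs v :
  adapted gamma (paths_through e v0 v) (floret_probs gamma v).
Proof.
rewrite /adapted (_ : floret_probs gamma v = fun x =>
    [tuple node_rate gamma (child i) x / node_rate gamma v x | i < outdeg e v]); last first.
  by apply/funext => x; exact: floret_probsE.
apply: measurable_floret_probs.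
- move=> w vw; apply: (adapted_sub (L := paths_through e v0 w)).
    exact: paths_through_child.
  exact: adapted_node_rate.
- exact: adapted_node_rate.
- by move=> x; exact: node_rate_gt0.
Qed.

(** The generators here are node rates, not path rates: the path rates through [v] would also
    determine the florets below [v], from which independence is sought. *)
Lemma generated_children_floret v : v \in situations e ->
  adapted (node_rate gamma) (children e v) (node_rate gamma v) /\
  adapted (node_rate gamma) (children e v) (floret_probs gamma v).
Proof.
move=> vS.
have ch w : e v w -> adapted (node_rate gamma) (children e v) (node_rate gamma w).
  by move=> vw; apply: adapted_coordinate; rewrite inE.
have av : adapted (node_rate gamma) (children e v) (node_rate gamma v).
  rewrite /adapted (_ : node_rate gamma v =
      fun x => \sum_(i < outdeg e v) node_rate gamma (child i) x); last first.
    by apply/funext => x; exact: node_rate_sum_child.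
  by apply: measurable_sum => i; apply: ch; exact: child_edge.
split => //.
rewrite /adapted (_ : floret_probs gamma v = fun x =>
    [tuple node_rate gamma (child i) x / node_rate gamma v x | i < outdeg e v]); last first.
  by apply/funext => x; exact: floret_probsE.
apply: measurable_floret_probs => //.
by move=> x; exact: node_rate_gt0.
Qed.

Lemma children_blocks v : {in enum (children e v) &, forall w w', w != w' ->
  [disjoint paths_through e v0 w & paths_through e v0 w']%B}.
Proof.
move=> w w'; rewrite !mem_enum !inE => vw vw' ww'.
exact: (paths_through_children_disjoint tree vw vw' ww').
Qed.

Hypothesis floret_indep : forall v, v \in situations e ->
  independent2 P (floret_probs gamma v) (node_rate gamma v).
Local Open Scope ereal_scope.

(** The rate of [v] is part of the statement because, one level up, the rates of the children have
    to be independent of the florets below them. *)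
Lemma subtree_independence v (J : {set V})
    (A : forall u, set ((outdeg e u).-tuple R)) (B : set R) :
  (forall u, measurable (A u)) -> measurable B ->
  J \subset situations e -> J \subset below e v ->
  P (node_rate gamma v @^-1` B `&`
     \bigcap_(u in [set` J]) (floret_probs gamma u @^-1` A u)) =
  P (node_rate gamma v @^-1` B) * \prod_(u in J) P (floret_probs gamma u @^-1` A u).
Proof.
move=> mA; have [n] := ubnP #|below e v|; elim: n v J B => // n IH v J B vn mB JS Jv.
pose D_ (K : {set V}) := \bigcap_(u in [set` K]) (floret_probs gamma u @^-1` A u).
(* A leaf has no situation below it, so [J] is empty. *)
have [vS|vS] := boolP (v \in situations e); last first.
  have -> : J = finset.set0.
    apply/setP => u; rewrite [RHS]inE; apply/negP => uJ.
    have := fintype.subsetP Jv _ uJ; rewrite inE => /connect_child[uv|[w vw _]].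
      by have := fintype.subsetP JS _ uJ; rewrite uv (negbTE vS).
    by move: vS; rewrite inE -leqNgt leqn0 cards_eq0 => /eqP/setP/(_ w); rewrite !inE vw.
  rewrite big_set0 mule1; congr (P _).
  by apply/seteqP; split => x /=; [case|move=> h; split => // u; rewrite /= inE].
have mF u : measurable (floret_probs gamma u @^-1` A u).
  rewrite -[X in measurable X]setTI.
  have h := @adapted_floret_probs u.
  exact: (adapted_measurable mgamma h measurableT (mA u)).
have mem_ch w : (w \in enum (children e v)) = e v w by rewrite mem_enum inE.
have gD (K : {set V}) w : K \subset below e w -> generated gamma (paths_through e v0 w) (D_ K).
  move=> Kw; apply: (@fin_bigcap_measurable _
      (g_sigma_algebraType (rectangles gamma (paths_through e v0 w)))) => // u uK.
  have := fintype.subsetP Kw _ uK; rewrite inE => wu.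
  apply: adapted_generated (mA u).
  exact: adapted_sub (paths_through_connect tree wu) (@adapted_floret_probs u).
(* Disjoint sets of paths separate the children, and the induction hypothesis splits each factor.
   [K] will be [J'], or empty to obtain the rates alone. *)
have block (B_ : V -> set R) (K : {set V}) : K \subset J -> (forall w, measurable (B_ w)) ->
    P (\bigcap_(w in [set` children e v])
       (node_rate gamma w @^-1` B_ w `&` D_ (K :&: below e w)%SET)) =
    \prod_(w in children e v) (P (node_rate gamma w @^-1` B_ w) *
     \prod_(u in (K :&: below e w)%SET) P (floret_probs gamma u @^-1` A u)).
  move=> KJ mB_.
  have -> : [set` children e v] = [set` enum (children e v)].
    by apply/seteqP; split => w /=; rewrite mem_enum.
  rewrite bigcap_seq (generated_blocks_indep mgamma indep_gamma (enum_uniq _)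
    (@children_blocks v)); last first.
    move=> w; rewrite mem_ch => vw; apply: generatedI.
      exact: adapted_generated (@adapted_node_rate w) (mB_ w).
    by apply: gD; exact: finset.subsetIr.
  rewrite big_enum /=; apply: eq_bigr => w; rewrite inE => vw.
  apply: IH => //.
  - by rewrite -ltnS; apply: leq_trans vn; rewrite ltnS; exact: below_child_card.
  - exact: fintype.subset_trans (finset.subsetIl _ _) (fintype.subset_trans KJ JS).
  - exact: finset.subsetIr.
pose J' := (J :\ v)%SET.
have J'J : J' \subset J by exact: finset.subsetDl.
have mD' : measurable (D_ J') by apply: fin_bigcap_measurable.
have capE (B_ : V -> set R) :
    \bigcap_(w in [set` children e v]) (node_rate gamma w @^-1` B_ w) `&` D_ J' =
    \bigcap_(w in [set` children e v])
       (node_rate gamma w @^-1` B_ w `&` D_ (J' :&: below e w)%SET).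
  apply/seteqP; split => x /= => [[hB hD] w vw|h]; split.
  - exact: hB.
  - by move=> u /=; rewrite inE => /andP[uJ _]; exact: hD.
  - by move=> w vw; have [] := h w vw.
  move=> u /= uJ; have := uJ; rewrite !inE => /andP[uv uJ0].
  have := fintype.subsetP Jv _ uJ0; rewrite inE => /connect_child[uv'|[w vw wu]].
    by rewrite uv' eqxx in uv.
  have /= := h w; rewrite inE => /(_ vw)[_]; apply.
  by rewrite /= !inE uv uJ0 wu.
have prodE : \prod_(w in children e v)
    \prod_(u in (J' :&: below e w)%SET) P (floret_probs gamma u @^-1` A u) =
    \prod_(u in J') P (floret_probs gamma u @^-1` A u).
  rewrite (exchange_big_dep (fun u => u \in J')) /=; last first.
    by move=> w u _; rewrite inE => /andP[].
  apply: eq_bigr => u uJ'; have := uJ'; rewrite !inE => /andP[uv uJ].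
  have := fintype.subsetP Jv _ uJ; rewrite inE => /connect_child[uv'|[w vw wu]].
    by rewrite uv' eqxx in uv.
  rewrite (big_pred1 w) // => w' /=; rewrite !inE uv uJ /=.
  apply/andP/eqP => [[vw' wu']|->]; last by rewrite vw wu.
  (* Two children above [u] share a path through [u], so they coincide and [u] is counted once. *)
  have [l lu] := paths_through_nonempty tree u.
  apply: (child_unique (l := l) tree vw' vw).
    exact: fintype.subsetP (paths_through_connect tree wu') _ lu.
  exact: fintype.subsetP (paths_through_connect tree wu) _ lu.
have PD' : P (D_ J') = \prod_(u in J') P (floret_probs gamma u @^-1` A u).
  have := block (fun=> setT) J' J'J (fun=> measurableT).
  rewrite -capE big_split /= prodE big1 ?mul1e; last first.
    by move=> w _; rewrite preimage_setT probability_setT.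
  move=> <-; congr (P _); apply/seteqP; split => x /=; last by case.
  by move=> h; split => // w _.
have rect_indep E : rectangles (node_rate gamma) (children e v) E ->
    P (E `&` D_ J') = P E * P (D_ J').
  move=> [B_ mB_ ->]; rewrite capE block // big_split /= prodE -PD'; congr (_ * _).
  have := block B_ finset.set0 (finset.sub0set _) mB_.
  rewrite [RHS](eq_bigr (fun w => P (node_rate gamma w @^-1` B_ w))); last first.
    by move=> w _; rewrite finset.set0I big_set0 mule1.
  move=> <-; congr (P _); apply: eq_bigcapr => w _.
  rewrite finset.set0I; apply/seteqP; split => x /=; first by case.
  by move=> h; split => // u; rewrite /= inE.
(* Extended from rectangles so as to include events on the rate and on the floret vector of [v]. *)
have gen_indep E : generated (node_rate gamma) (children e v) E ->
    P (E `&` D_ J') = P E * P (D_ J').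
  apply: sigma_algebra_indep_event => //.
  - by apply: rectangles_measurable => w; exact: measurable_node_rate.
  - exact: rectangles_setI.
  - exact: rectangles_setT.
have [av aF] := generated_children_floret vS.
have gv : generated (node_rate gamma) (children e v) (node_rate gamma v @^-1` B).
  exact: adapted_generated av mB.
have [vJ|vJ] := boolP (v \in J); last first.
  have J'E : J' = J.
    apply/setP => u; rewrite !inE; case: eqVneq => // ->.
    by rewrite (negbTE vJ).
  by rewrite -{1}J'E gen_indep // PD' J'E.
have gF : generated (node_rate gamma) (children e v) (floret_probs gamma v @^-1` A v).
  exact: adapted_generated aF (mA v).
have -> : \bigcap_(u in [set` J]) (floret_probs gamma u @^-1` A u) =
    (floret_probs gamma v @^-1` A v) `&` D_ J'.
  apply/seteqP; split => x /=.
    move=> h; split; first exact: h.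
    by move=> u /=; rewrite !inE => /andP[_ uJ]; exact: h.
  move=> [hv h] u /= uJ; have [->|uv] := eqVneq u v; first exact: hv.
  by apply: h; rewrite /= !inE uv.
(* The lower florets are split off from both events at [v] at once; then [floret_indep] separates
   these two. *)
rewrite setIA gen_indep; last exact: generatedI.
rewrite PD' setIC (floret_indep vS (mA v) mB) muleC [in RHS](big_setD1 v) //=.
by rewrite muleCA [RHS]muleCA; congr (_ * _); exact: muleC.
Qed.

(** One path through [v] is singled out: its atomless rate is independent of the sum of the
    others. *)
Lemma node_rate_atomless v (c : R) :
  (forall l x, P (gamma l @^-1` [set x]) = 0) -> P (node_rate gamma v @^-1` [set c]) = 0.
Proof.
move=> atomless; have [l lv] := paths_through_nonempty tree v.
pose L := (paths_through e v0 v :\ l)%SET.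
pose g x := (\sum_(j in L) gamma j x)%R.
have lL : [disjoint [set l]%SET & L]%B.
  by apply/pred0P => j /=; rewrite !inE; case: eqP.
have al : adapted gamma [set l]%SET (gamma l) by apply: adapted_coordinate; rewrite inE.
have ag : adapted gamma L g by exact: adapted_sum_rates.
pose fM := isMeasurableFun.Build _ _ _ _ (gamma l) (mgamma l).
pose gM := isMeasurableFun.Build _ _ _ _ g (adapted_measurable mgamma ag).
pose fRV : {RV P >-> R} := HB.pack (gamma l) fM.
pose gRV : {RV P >-> R} := HB.pack g gM.
have fg : independent2 P fRV gRV.
  exact: (adapted_independent2 mgamma indep_gamma lL al ag).
rewrite -(independent2_add_atomless c fg); last by move=> x; exact: atomless.
have -> // : node_rate gamma v = (fun x => fRV x + gRV x)%R.
by apply/funext => x; rewrite node_rateE (big_setD1 l).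
Qed.

Lemma children_rates_independent v :
  mutually_independent P [set: 'I_(outdeg e v)]%SET (fun i => node_rate gamma (child i)).
Proof.
move=> J _ A mA.
have -> : [set` J] = [set` enum J] by apply/seteqP; split => i /=; rewrite mem_enum.
rewrite bigcap_seq (generated_blocks_indep mgamma indep_gamma (enum_uniq _)
  (L := fun i => paths_through e v0 (child i))) ?big_enum //.
- move=> i j _ _ ij; apply: (paths_through_children_disjoint tree
    (child_edge i) (child_edge j)).
  by apply: contra ij => /eqP /enum_val_inj ->.
- move=> i _; exact: (adapted_generated (@adapted_node_rate _) (mA i)).
Qed.

End path_rates.

Theorem theorem5 (R : realType) (d : measure_display) (Omega : measurableType d)
    (P : probability Omega R)
    (V : finType) (e : rel V) (v0 : V)
    (gamma : rtl_path e v0 -> {RV P >-> R}) :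
  event_tree e v0 ->
  (forall l omega, 0 < gamma l omega) ->
  (forall l, has_density (gamma l)) ->
  mutually_independent P [set: rtl_path e v0]%SET (fun l => gamma l) ->
  (forall v, v \in situations e ->
     independent2 P (floret_probs gamma v) (node_rate gamma v)) ->
  mutually_independent P (nontrivial_florets e (finest_staging e))
    (floret_probs gamma) /\
  (forall v, v \in nontrivial_florets e (finest_staging e) ->
     has_dirichlet_distribution P (floret_probs gamma v)).
Proof.
move=> tree gamma0 dens indep floret_indep.
have mgamma l : measurable_fun setT (gamma l : Omega -> R) by [].
have sit v : v \in nontrivial_florets e (finest_staging e) ->
    v \in situations e /\ (1 < outdeg e v)%N.
  by rewrite !inE => /andP[_ v1]; split => //; exact: ltnW.
split=> [J Jnt A mA|v /sit[vS v1]].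
  have JS : J \subset situations e.
    by apply/fintype.subsetP => v vJ; have [] := sit v (fintype.subsetP Jnt v vJ).
  have J0 : J \subset below e v0.
    apply/fintype.subsetP => v _; rewrite inE; have [p ep <-] := walk_exists tree v.
    by apply/connectP; exists p.
  (* At the root, with the sure event for the rate, the subtree is the whole tree. *)
  have := subtree_independence tree gamma0 mgamma indep floret_indep mA
    (measurableT : measurable [set: R]) JS J0.
  by rewrite preimage_setT setTI probability_setT mul1e.
pose X i := node_rate (fun l => gamma l : Omega -> R) (@child V e v i).
have sumX x : \sum_i X i x = node_rate gamma v x by rewrite -node_rate_sum_child.
have floretE : floret_probs gamma v = fun x => [tuple X i x / \sum_j X j x | i < outdeg e v].
  by apply/funext => x; rewrite sumX floret_probsE.
rewrite [X in has_dirichlet_distribution P X]floretE.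
(* [Ordinal v1] is the second child; any child would serve as the one with an atomless rate. *)
apply: (@lukacs_dirichlet _ _ _ P (outdeg e v) X (Ordinal v1)) => //.
- by move=> i; exact: measurable_node_rate.
- by move=> i x; exact: node_rate_gt0.
- exact: children_rates_independent.
- rewrite -floretE (_ : (fun x => _) = node_rate gamma v); last exact/funext.
  exact: floret_indep.
- move=> c; apply: node_rate_atomless => // l x.
  (* A density gives singletons mass 0, as they are null for Lebesgue measure. *)
  have [f [_ _ fE]] := dens l.
  have := fE [set x] (measurable_set1 x); rewrite integral_set1; exact.
Qed.
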